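(* Let $a$ be an integer with $|a|>1$ and $\gcd(a,s)=1$. If $|a|>C$, where \[ \log C=mS+(m+1)\Big(3+\log\big(d\,\tilde d\,s_0\,\epsilon(s_0)\,\epsilon(s)^2\,\epsilon(v)\big)+2s_0+(m+1)V\Big), \] then there is no $a$-global relation, i.e. there is no $(\ell_0,\dots,\ell_m)\in\mathbb{Z}^{m+1}\setminus\{0\}$ such that $\ell_0+\ell_1\varphi_1(a)+\cdots+\ell_m\varphi_m(a)=0$ holds in $\mathbb{Q}_p$ for every prime $p\mid a$.
   Context: Let $m\ge1$ and let $\alpha_0,\alpha_1,\dots,\alpha_m$ be positive rational numbers with $\alpha_i-\alpha_j\notin\mathbb{Z}$ for $1\le i<j\le m$. Pochhammer symbol: $(x)_0=1$, $(x)_n=x(x+1)\cdots(x+n-1)$. $\varphi_j(z)=\sum_{n\ge0}\frac{(\alpha_j)_n}{(\alpha_j+\alpha_0)_n}z^n$; for a prime $p\mid a$ with $\gcd(a,s)=1$ the series converges in $\mathbb{Q}_p$ at $z=a$ and $\varphi_j(a)$ denotes its $p$-adic sum. Write $\alpha_j=r_j/s_j$ ($j=0,\dots,m$) and $\alpha_j+\alpha_0=u_j/v_j$ ($j=1,\dots,m$) with positive integers in lowest terms; $S=\max_{1\le j\le m}s_j$, $V=\max_{1\le j\le m}v_j$; $d_j$ is the positive integer with $s_0s_j=d_jv_j$; $s,v,d$ are the least common multiples of $s_j$, $v_j$, $d_j$ ($j=1,\dots,m$); $\tilde d=d/\gcd(d,s_0)$; $\epsilon(n)=\prod_{p\mid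 n}p^{1/(p-1)}$ (product over primes). *)

(* Defs.v *)
From Stdlib Require Export Reals QArith ZArith Znumtheory List Lia.
Open Scope Z_scope.

Fixpoint poch (x : Q) (n : nat) : Q :=
  match n with
  | O => 1%Q
  | S k => (poch x k * (x + inject_Z (Z.of_nat k)))%Q
  end.

Fixpoint sumQ (f : nat -> Q) (n : nat) : Q :=
  match n with
  | O => 0%Q
  | S k => (sumQ f k + f k)%Q
  end.

Definition sden (alpha : nat -> Q) (j : nat) : Z := Zpos (Qden (Qred (alpha j))).
Definition vden (alpha : nat -> Q) (j : nat) : Z :=
  Zpos (Qden (Qred (alpha j + alpha O)%Q)).
(* d_j with s_0 s_j = d_j v_j *)
Definition dj (alpha : nat -> Q) (j : nat) : Z :=
  (sden alpha O * sden alpha j) / vden alpha j.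

Fixpoint lcm_1 (f : nat -> Z) (m : nat) : Z :=
  match m with
  | O => 1
  | S k => Z.lcm (lcm_1 f k) (f (S k))
  end.
Fixpoint max_1 (f : nat -> Z) (m : nat) : Z :=
  match m with
  | O => 0
  | S k => Z.max (max_1 f k) (f (S k))
  end.

Definition eps_factor (n p : Z) : R :=
  if prime_dec p then
    if Zdivide_dec p n then Rpower (IZR p) (/ (IZR p - 1))%R else 1%R
  else 1%R.
Definition eps (n : Z) : R :=
  fold_right Rmult 1%R
    (map (eps_factor n) (map Z.of_nat (seq 2 (Z.to_nat (Z.abs n))))).

Definition s_l (m : nat) (alpha : nat -> Q) : Z := lcm_1 (sden alpha) m.
Definition v_l (m : nat) (alpha : nat -> Q) : Z := lcm_1 (vden alpha) m.
Definition d_l (m : nat) (alpha : nat -> Q) : Z := lcm_1 (dj alpha) m.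
Definition dtilde (m : nat) (alpha : nat -> Q) : Z :=
  d_l m alpha / Z.gcd (d_l m alpha) (sden alpha O).
Definition Smax (m : nat) (alpha : nat -> Q) : Z := max_1 (sden alpha) m.
Definition Vmax (m : nat) (alpha : nat -> Q) : Z := max_1 (vden alpha) m.

Definition logC (m : nat) (alpha : nat -> Q) : R :=
  (INR m * IZR (Smax m alpha)
   + (INR m + 1) *
     (3 + ln (IZR (d_l m alpha) * IZR (dtilde m alpha) * IZR (sden alpha O)
              * eps (sden alpha O) * (eps (s_l m alpha))^2 * eps (v_l m alpha))
      + 2 * IZR (sden alpha O) + (INR m + 1) * IZR (Vmax m alpha)))%R.

(* x is divisible by p^k in Z_(p), i.e. |x|_p <= p^{-k} (x = 0 allowed). *)
Definition padic_small (p : Z) (k : nat) (x : Q) : Prop :=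
  exists u w : Z, ~ (p | w) /\ (x * inject_Z w == inject_Z (p ^ Z.of_nat k * u))%Q.

Definition padic_tends_to_0 (p : Z) (x : nat -> Q) : Prop :=
  forall k : nat, exists N0 : nat, forall N : nat, (N0 <= N)%nat -> padic_small p k (x N).

Definition phi_partial (alpha : nat -> Q) (j : nat) (a : Z) (N : nat) : Q :=
  sumQ (fun n => poch (alpha j) n / poch (alpha j + alpha O)%Q n
                 * inject_Z (a ^ Z.of_nat n))%Q N.

Definition rel_partial (m : nat) (alpha : nat -> Q) (l : nat -> Z) (a : Z) (N : nat) : Q :=
  (inject_Z (l O) + sumQ (fun i => inject_Z (l (S i)) * phi_partial alpha (S i) a N) m)%Q.

Definition a_global_relation (m : nat) (alpha : nat -> Q) (a : Z) : Prop :=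
  exists l : nat -> Z, (exists j, (j <= m)%nat /\ l j <> 0) /\
    forall p : Z, prime p -> (p | a) -> padic_tends_to_0 p (rel_partial m alpha l a).

(* Main.v *)
(* Write c_i(x) = (x)_i / (x + alpha_0)_i, let w_k be the k-th partial sum
   l_0 + sum_j l_j sum_(i < k) c_i(alpha_j) a^i of the relation, and fix M = m (N + 1).
   The polynomials e_k(x) = (x)_k (x + alpha_0 + k)_(M - k) = (x + alpha_0)_M c_k(x), k <= M,
   form a basis of the polynomials of degree at most M whose coordinate functions q_k are
   explicit (up to the factor (alpha_0)_M), by the Vandermonde identity.  For
   G = x^e prod_j prod_(b < N) (x - alpha_j - b), e <= m, the polynomial
   sum_k q_k(G) z^(M - k) is therefore a simultaneous Pade denominator: its product with
   phi_j has no term z^(M + b) with b < N.  For a relation, the number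
   L(G) = sum_k q_k(G) a^(M - k) w_k is thus divisible by a^(M + N) at every prime p | a,
   up to the denominators of the c_i(alpha_j), whereas |L(G)| is at most K^N |a|^M.
   Clearing denominators costs another exponential factor, so L(G) = 0 when |a| > C.

   Conversely, L cannot vanish for all e <= m.  Comparing x G(x + 1) with (x + alpha_0 + M) G(x)
   gives a functional equation whose right side is sum_j l_j G(alpha_j) / (alpha_j + alpha_0)_M
   up to a nonzero factor; interpolation at the points alpha_j + b, b <= N, then yields
   l_j = 0 for j >= 1, and l_0 = 0 follows since l_0 is divisible by every power of p. *)

Require Import Defs.
From Stdlib Require Import Lra.
From Stdlib Require Qcanon.
From mathcomp Require all_boot all_order all_algebra ring lra zify ssrZ.

(** * A lower bound for [logC] *)

(** Squaring [exp (x / 4) >= 1 + x / 4] gives [exp (x / 2) >= x + (1 - x / 4) ^ 2]. *)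
Lemma ln_le_half (x : R) : (0 < x -> ln x <= x / 2)%R.
Proof.
intros hx; apply Rnot_lt_le; intros h.
assert (h1 : (exp (x / 2) < x)%R) by (rewrite <- (exp_ln x hx) at 2; now apply exp_increasing).
assert (h2 := exp_ineq1_le (x / 4)).
replace (x / 2)%R with (x / 4 + x / 4)%R in h1 by field; rewrite exp_plus in h1.
assert (h3 := pow2_ge_0 (1 - x / 4)); nra.
Qed.

Lemma ln_le_pred (x : R) : (0 < x -> ln x <= x - 1)%R.
Proof.
intros hx; assert (h := exp_ineq1_le (ln x)); rewrite (exp_ln x hx) in h; lra.
Qed.

(** [exp (3 / 4)] is the sixth power of [exp (1 / 8) >= 9 / 8], and [(9 / 8) ^ 6 > 2]. *)
Lemma ln_2_le : (ln 2 <= 3 / 4)%R.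
Proof.
apply Rnot_lt_le; intros h.
assert (h1 : (exp (3 / 4) < 2)%R) by (rewrite <- (exp_ln 2) by lra; now apply exp_increasing).
assert (h2 := exp_ineq1_le (1 / 8)).
replace (3 / 4)%R with (1 / 8 + (1 / 8 + (1 / 8 + (1 / 8 + (1 / 8 + 1 / 8)))))%R in h1 by field.
rewrite !exp_plus in h1; set (y := exp (1 / 8)) in *.
assert (h3 : (1.25 <= y * y)%R) by nra.
assert (h4 : (1.5625 <= y * y * (y * y))%R) by nra.
nra.
Qed.

Lemma ln_monotone (x y : R) : (0 < x -> x <= y -> ln x <= ln y)%R.
Proof. intros hx [h | <-]; [left; now apply ln_increasing | lra]. Qed.

Lemma ln_ge_0 (x : R) : (1 <= x -> 0 <= ln x)%R.
Proof. intros h; rewrite <- ln_1; apply ln_monotone; lra. Qed.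

Lemma eps_ge_1 (n : Z) : (1 <= eps n)%R.
Proof.
unfold eps; induction (seq 2 _) as [|q l IH]; simpl; [lra|].
apply Rle_trans with (1 * 1)%R; [lra|].
apply Rmult_le_compat; [lra | lra | | exact IH].
unfold eps_factor; destruct prime_dec as [hp|]; [|lra].
destruct Zdivide_dec; [|lra].
assert (h2 := IZR_le _ _ (prime_ge_2 _ hp)).
apply Rle_trans with (Rpower (IZR (Z.of_nat q)) 0); [rewrite Rpower_O; lra|].
apply Rle_Rpower; [lra|]; left; apply Rinv_0_lt_compat; lra.
Qed.

Lemma sden_pos alpha j : 1 <= sden alpha j.
Proof. unfold sden; lia. Qed.

Lemma vden_pos alpha j : 1 <= vden alpha j.
Proof. unfold vden; lia. Qed.

Lemma max_1_ge f m j : (1 <= j <= m)%nat -> f j <= max_1 f m.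
Proof.
induction m as [|m IH]; simpl; intros h; [lia|].
destruct (Nat.eq_dec j (S m)) as [->|]; [lia|].
specialize (IH ltac:(lia)); lia.
Qed.

Lemma lcm_1_dvd f m j : (1 <= j <= m)%nat -> (f j | lcm_1 f m).
Proof.
induction m as [|m IH]; simpl; intros h; [lia|].
destruct (Nat.eq_dec j (S m)) as [->|]; [apply Z.divide_lcm_r|].
apply Z.divide_trans with (lcm_1 f m); [apply IH; lia | apply Z.divide_lcm_l].
Qed.

Lemma lcm_1_pos f m : (forall j, (1 <= j <= m)%nat -> f j <> 0) -> 0 < lcm_1 f m.
Proof.
induction m as [|m IH]; simpl; intros h; [lia|].
assert (h1 : 0 < lcm_1 f m) by (apply IH; intros j hj; apply h; lia).
assert (h2 := Z.lcm_nonneg (lcm_1 f m) (f (S m))).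
enough (Z.lcm (lcm_1 f m) (f (S m)) <> 0) by lia.
intros h3; apply Z.lcm_eq_0 in h3; destruct h3 as [h3|h3]; [lia|].
now apply (h (S m)); [lia|].
Qed.

Lemma Qred_coprime (q : Q) : Z.gcd (Qnum (Qred q)) (QDen (Qred q)) = 1.
Proof. apply Qcanon.Qred_iff, Qcanon.Qred_involutive. Qed.

(* The common denominator [s_0 s_j] of [alpha_j + alpha_0] is a multiple of its
   reduced denominator [v_j]. *)
Lemma vden_dvd alpha j : (vden alpha j | sden alpha O * sden alpha j).
Proof.
unfold vden, sden.
assert (E : (Qred (alpha j + alpha O) == Qred (alpha j) + Qred (alpha O))%Q)
  by (rewrite !Qred_correct; reflexivity).
assert (C := Qred_coprime (alpha j + alpha O)).
destruct (Qred (alpha j + alpha O)) as [u v], (Qred (alpha j)) as [r s],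
  (Qred (alpha O)) as [r0 s0]; unfold Qeq in E; simpl in *.
apply (Z.gauss _ u); [|rewrite Z.gcd_comm; exact C].
exists (r * Zpos s0 + r0 * Zpos s); rewrite Pos.mul_comm; exact E.
Qed.

Lemma dj_vden alpha j : sden alpha O * sden alpha j = dj alpha j * vden alpha j.
Proof.
unfold dj; destruct (vden_dvd alpha j) as [q ->].
rewrite Z.div_mul; [ring | assert (h := vden_pos alpha j); lia].
Qed.

Lemma dj_pos alpha j : 1 <= dj alpha j.
Proof.
assert (h := dj_vden alpha j); assert (h1 := sden_pos alpha j).
assert (h2 := sden_pos alpha O); assert (h3 := vden_pos alpha j); nia.
Qed.

Lemma d_l_pos m alpha : 1 <= d_l m alpha.
Proof.
enough (0 < d_l m alpha) by lia.
apply lcm_1_pos; intros j _; assert (h := dj_pos alpha j); lia.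
Qed.

(** With [g] the gcd, [d = dtilde * g] and [g <= s_0]. The estimate of [logC] needs two factors [d]
    where the constant offers one [d] and one [dtilde]; this inequality makes up the difference. *)
Lemma d_l_le m alpha : 1 <= dtilde m alpha /\ d_l m alpha <= dtilde m alpha * sden alpha O.
Proof.
unfold dtilde; assert (h1 := d_l_pos m alpha); assert (h2 := sden_pos alpha O).
destruct (Z.gcd_divide_l (d_l m alpha) (sden alpha O)) as [q hq].
assert (h3 := Z.gcd_nonneg (d_l m alpha) (sden alpha O)).
assert (h4 : Z.gcd (d_l m alpha) (sden alpha O) <= sden alpha O)
  by (apply Z.divide_pos_le; [lia | apply Z.gcd_divide_r]).
set (g := Z.gcd (d_l m alpha) (sden alpha O)) in *.
assert (h5 : 0 < g) by (destruct (Z.eq_dec g 0) as [E|]; [rewrite E in hq|]; lia).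
assert (h6 : d_l m alpha / g = q) by (rewrite hq at 1; apply Z.div_mul; lia).
rewrite h6; split; nia.
Qed.

(* The factors [eps] are only used through [1 <= eps]; this leaves enough room for the crude
   estimates [lcm(1..n) <= 4^n] and ['C(n, k) <= 2^n] used later. *)
Lemma logC_lower_bound m alpha : (1 <= m)%nat ->
  (ln (2 ^ (m * m + 4 * m + 4) * IZR (sden alpha O) ^ (2 * m) * IZR (Smax m alpha) ^ (2 * m)
     * IZR (d_l m alpha) ^ (2 * m) * 4 ^ (S m * Z.to_nat (Vmax m alpha))) <= logC m alpha)%R.
Proof.
intros hm; unfold logC.
assert (hs := IZR_le _ _ (sden_pos alpha O)); assert (hd := IZR_le _ _ (d_l_pos m alpha)).
destruct (d_l_le m alpha) as [ht hdt]; apply IZR_le in ht; apply IZR_le in hdt.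
rewrite mult_IZR in hdt.
assert (hS : 1 <= Smax m alpha)
  by (apply Z.le_trans with (2 := max_1_ge _ m 1 ltac:(lia)); apply sden_pos).
assert (hV : 1 <= Vmax m alpha)
  by (apply Z.le_trans with (2 := max_1_ge _ m 1 ltac:(lia)); apply vden_pos).
assert (hVn : INR (Z.to_nat (Vmax m alpha)) = IZR (Vmax m alpha))
  by (rewrite INR_IZR_INZ, Z2Nat.id by lia; reflexivity).
apply IZR_le in hS; apply IZR_le in hV.
assert (he0 := eps_ge_1 (sden alpha O)); assert (hes := eps_ge_1 (s_l m alpha)).
assert (hev := eps_ge_1 (v_l m alpha)).
set (s0 := IZR (sden alpha O)) in *; set (d := IZR (d_l m alpha)) in *.
set (t := IZR (dtilde m alpha)) in *; set (S1 := IZR (Smax m alpha)) in *.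
set (V := IZR (Vmax m alpha)) in *; set (e0 := eps (sden alpha O)) in *.
set (es := eps (s_l m alpha)) in *; set (ev := eps (v_l m alpha)) in *.
assert (pw : forall x n, (1 <= x -> 0 < x ^ n)%R) by (intros; apply pow_lt; lra).
assert (p2 : (0 < 2 ^ (m * m + 4 * m + 4))%R) by (apply pw; lra).
assert (p4 : (0 < 4 ^ (S m * Z.to_nat (Vmax m alpha)))%R) by (apply pw; lra).
rewrite !ln_mult by (repeat apply Rmult_lt_0_compat; auto; lra).
rewrite !ln_pow by lra.
replace (ln 4) with (2 * ln 2)%R by
  (replace 4%R with (2 * 2)%R by ring; rewrite ln_mult by lra; ring).
rewrite !mult_INR, !plus_INR, !mult_INR, hVn, (S_INR m).
replace (INR 2) with 2%R by (simpl; ring); replace (INR 4) with 4%R by (simpl; ring).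
assert (hM := le_INR _ _ hm); change (INR 1) with 1%R in hM.
set (M := INR m) in *.
assert (l0 := ln_le_pred s0 ltac:(lra)); assert (lS := ln_le_half S1 ltac:(lra)).
assert (l2 := ln_2_le); assert (le0 := ln_ge_0 e0 he0); assert (les := ln_ge_0 es hes).
assert (lev := ln_ge_0 ev hev); assert (l20 := ln_ge_0 2 ltac:(lra)).
assert (ld : (ln d <= ln t + ln s0)%R)
  by (rewrite <- ln_mult by lra; apply ln_monotone; lra).
assert (ld0 := ln_ge_0 d hd); assert (lt0 := ln_ge_0 t ht); assert (ls0 := ln_ge_0 s0 hs).
set (L2 := ln 2) in *; set (D := ln d) in *; set (T := ln t) in *; set (L0 := ln s0) in *.
set (LS := ln S1) in *.
set (E := (ln e0 + INR 2 * ln es + ln ev)%R).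
assert (hE : (0 <= E)%R) by (unfold E; simpl; lra).
(* [a1] pays for [S] with the term [m S], [a2] for [d], and [a3] for [s_0], with a surplus of
   [2 (m + 1)]. The powers of 2 and 4 ([a4], [a5]) are absorbed by this surplus, by the constant 3
   and by [(m + 1) V], where [a6] uses [V >= 1]. *)
assert (a1 : (2 * M * LS <= M * S1)%R) by nra.
assert (a2 : (2 * M * D <= (M + 1) * (D + T + L0))%R) by nra.
assert (a3 : (2 * M * L0 <= (M + 1) * (2 * s0 - 2))%R) by nra.
assert (a4 : ((M * M + 4 * M + 4) * L2 <= (M * M + 4 * M + 4) * (3 / 4))%R) by nra.
assert (a5 : ((M + 1) * V * (2 * L2) <= (M + 1) * V * (3 / 2))%R)
  by (apply Rmult_le_compat_l; [apply Rmult_le_pos|]; lra).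
assert (a6 : (0 <= (M + 1) * (M - 1 / 2) * (V - 1))%R)
  by (apply Rmult_le_pos; [apply Rmult_le_pos|]; lra).
assert (a7 : (0 <= (M + 1) * E)%R) by nra.
assert (a8 : (0 <= M * M)%R) by (apply Rmult_le_pos; lra).
unfold E in *; simpl (INR 2) in *; lra.
Qed.

(** This integer inequality is all that the arithmetic part of the proof uses of [logC]. *)
Lemma abs_lower_bound m alpha (a : Z) : (1 <= m)%nat -> 1 < Z.abs a ->
  (ln (IZR (Z.abs a)) > logC m alpha)%R ->
  2 ^ Z.of_nat (m * m + 4 * m + 4) * sden alpha O ^ Z.of_nat (2 * m)
    * Smax m alpha ^ Z.of_nat (2 * m) * d_l m alpha ^ Z.of_nat (2 * m)
    * 4 ^ Z.of_nat (S m * Z.to_nat (Vmax m alpha)) <= Z.abs a.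
Proof.
intros hm ha h; assert (b := logC_lower_bound m alpha hm).
apply Z.lt_le_incl, lt_IZR; rewrite !mult_IZR, <- !pow_IZR.
apply ln_lt_inv; [| apply IZR_lt; lia | lra].
assert (hS : 1 <= Smax m alpha)
  by (apply Z.le_trans with (2 := max_1_ge _ m 1 ltac:(lia)); apply sden_pos).
assert (hs := sden_pos alpha O); assert (hd := d_l_pos m alpha).
repeat apply Rmult_lt_0_compat; apply pow_lt; apply IZR_lt; lia.
Qed.

Lemma Qplus_pos (p q : Q) : (0 < p -> 0 < q -> 0 < p + q)%Q.
Proof.
intros hp hq; rewrite <- (Qplus_0_l 0).
apply Qplus_lt_le_compat; [exact hp | now apply Qlt_le_weak].
Qed.

Module Core.
Import all_boot all_order all_algebra ring lra zify ssrZ.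
Set Implicit Arguments. Unset Strict Implicit. Unset Printing Implicit Defensive.
Import Order.TTheory GRing.Theory Num.Theory.
Local Open Scope ring_scope.

(** * Rising factorials and the dual basis *)

Section Pochhammer.
Variable F : numFieldType.
Implicit Types (x y : F) (n k : nat).

Definition rising x n : F := \prod_(t < n) (x + t%:R).

Lemma rising0 x : rising x 0 = 1. Proof. by rewrite /rising big_ord0. Qed.

Lemma risingSr x n : rising x n.+1 = rising x n * (x + n%:R).
Proof. by rewrite /rising big_ord_recr. Qed.

Lemma risingD x n k : rising x (n + k) = rising x n * rising (x + n%:R) k.
Proof.
elim: k => [|k IH]; first by rewrite addn0 rising0 mulr1.
by rewrite addnS !risingSr IH natrD addrA mulrA.
Qed.

Lemma risingSl x n : rising x n.+1 = x * rising (x + 1) n.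
Proof. by rewrite -addn1 addnC risingD risingSr rising0 mul1r mulr0n addr0. Qed.

Lemma rising_gt0 x n : 0 < x -> 0 < rising x n.
Proof. by move=> x0; apply: prodr_gt0 => t _; rewrite ltr_wpDr. Qed.

Lemma rising_neq0 x n : 0 < x -> rising x n != 0.
Proof. by move=> x0; rewrite gt_eqF // rising_gt0. Qed.

(** The coefficient of [z ^ n] in [(1 - z) ^ (- x)]; hence the convolution identity
    [mbinom_vandermonde]. *)
Definition mbinom x n : F := rising x n / n`!%:R.

Lemma mbinom0 x : mbinom x 0 = 1.
Proof. by rewrite /mbinom rising0 divr1. Qed.

Lemma fact_neq0 n : n`!%:R != 0 :> F.
Proof. by rewrite pnatr_eq0 -lt0n fact_gt0. Qed.

Lemma mbinomS x n : n.+1%:R * mbinom x n.+1 = (x + n%:R) * mbinom x n.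
Proof.
rewrite /mbinom risingSr factS natrM; have := fact_neq0 n.
have : n.+1%:R != 0 :> F by rewrite pnatr_eq0.
by move: n`!%:R n.+1%:R => f s s0 f0; field; rewrite s0 f0.
Qed.

(** Induction after multiplying by [n.+1]. Writing [n.+1 = i + (n.+1 - i)] splits the sum in two;
    [mbinomS] lowers one index in each half, and the factors [x + i] and [y + (n - i)] add up to
    [x + y + n]. *)
Lemma mbinom_vandermonde x y n :
  \sum_(k < n.+1) mbinom x k * mbinom y (n - k) = mbinom (x + y) n.
Proof.
elim: n => [|n IH]; first by rewrite big_ord_recl big_ord0 !mbinom0 addr0 mulr1.
have n0 : n.+1%:R != 0 :> F by rewrite pnatr_eq0.
apply: (mulfI n0); rewrite mbinomS -IH mulr_sumr mulr_sumr.
have -> : \sum_(i < n.+2) n.+1%:R * (mbinom x i * mbinom y (n.+1 - i)) =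
  \sum_(i < n.+2) i%:R * mbinom x i * mbinom y (n.+1 - i)
  + \sum_(i < n.+2) mbinom x i * ((n.+1 - i)%:R * mbinom y (n.+1 - i)).
  rewrite -big_split /=; apply: eq_bigr => i _.
  have ->: n.+1%:R = i%:R + (n.+1 - i)%:R :> F by rewrite -natrD subnKC // -ltnS.
  by ring.
(* The term [i = 0] of the first sum and the term [i = n.+1] of the second have a zero factor. *)
rewrite big_ord_recl /= mulr0n !mul0r add0r [in X in _ + X]big_ord_recr /=.
rewrite subnn mulr0n mul0r mulr0 addr0.
rewrite -big_split /=; apply: eq_bigr => i _.
rewrite /bump leq0n add1n subSS mbinomS subSn -1?ltnS // mbinomS.
have ->: n%:R = i%:R + (n - i)%:R :> F by rewrite -natrD subnKC // -ltnS.
by ring.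
Qed.

End Pochhammer.

(** * Explicit coordinates with respect to the basis [ebasis] *)

Section Interpolation.
Variable F : numFieldType.
Variable c : F.
Hypothesis c_gt0 : 0 < c.
Implicit Types (G : {poly F}) (M k : nat).

Definition ebasis M k : {poly F} :=
  (\prod_(t < k) ('X + t%:R%:P)) * (\prod_(t < M - k) ('X + (c + k%:R + t%:R)%:P)).

Lemma horner_ebasis M k x :
  (ebasis M k).[x] = rising x k * rising (x + c + k%:R) (M - k).
Proof.
rewrite /ebasis hornerM !horner_prod; congr (_ * _); apply: eq_bigr => t _;
  by rewrite hornerD hornerX hornerC // !addrA.
Qed.

Lemma size_prod_XaddC (I : finType) (f : I -> F) :
  size (\prod_i ('X + (f i)%:P)) = #|I|.+1.
Proof.
rewrite size_prod => [|i _]; last by rewrite -size_poly_eq0 size_XaddC.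
rewrite (eq_bigr (fun=> 2%N)) => [|i _]; last by rewrite size_XaddC.
by rewrite sum_nat_const muln2 -addnn -addSn addnK.
Qed.

Lemma size_ebasis M k : (k <= M)%N -> size (ebasis M k) = M.+1.
Proof.
move=> kM; have s := size_prod_XaddC; rewrite /ebasis size_mul -?size_poly_eq0 ?s //.
by rewrite !card_ord /= addnS subnKC.
Qed.

(** The [k]-th coordinate of [G] in the basis [ebasis M], times [rising c M]. Only the values at
    [0, -1, ..., -k] enter: [ebasis M i] vanishes at [- l] for [l < i], so the matrix of values is
    triangular, and this sum applies its inverse. *)
Definition ecoef M G k : F :=
  \sum_(l < k.+1) mbinom (c - 1) (k - l) * mbinom (1 - c - M%:R) l * G.[- l%:R].

Lemma ecoefD M G H k : ecoef M (G + H) k = ecoef M G k + ecoef M H k.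
Proof. by rewrite -big_split; apply: eq_bigr => l _; rewrite hornerD mulrDr. Qed.

Lemma ecoefZ M b G k : ecoef M (b *: G) k = b * ecoef M G k.
Proof. by rewrite mulr_sumr; apply: eq_bigr => l _; rewrite hornerZ mulrCA. Qed.

Lemma rising_neg_nat i l : rising (- l%:R : F) i = if (i <= l)%N
  then (-1) ^+ i * (l`!%:R / (l - i)`!%:R) else 0.
Proof.
elim: i => [|i IH]; first by rewrite rising0 subn0 expr0 mul1r divff ?fact_neq0.
rewrite risingSr IH; case: ltngtP => [il|li|->]; last by rewrite addNr mulr0.
  have ->: (l - i = (l - i.+1).+1)%N by lia.
  rewrite factS natrM exprS.
  have -> : l%:R = i%:R + (l - i.+1).+1%:R :> F by rewrite -natrD; congr (_%:R); lia.
  have := fact_neq0 F (l - i.+1).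
  have : (l - i.+1).+1%:R != 0 :> F by rewrite pnatr_eq0.
  by move: (l - i.+1)`!%:R (l - i.+1).+1%:R => f s s0 f0; field; rewrite s0 f0.
by rewrite mul0r.
Qed.

(** The factors on the right are the negatives of those on the left, in reverse order. *)
Lemma rising_reflect (x : F) n : rising x n = (-1) ^+ n * rising (1 - x - n%:R) n.
Proof.
elim: n => [|n IH]; first by rewrite !rising0 mulr1.
rewrite risingSr IH risingSl exprS.
have -> : 1 - x - n.+1%:R + 1 = 1 - x - n%:R by rewrite -natr1; ring.
rewrite -natr1; ring.
Qed.

(** The point is that the product depends on [l] and [i] only through [r = l - i], which makes the
    Vandermonde identity applicable. After reflection it amounts to splitting
    [rising (c - r) (M + r)] in two ways ([E1]). *)
Lemma ecoef_term M i l : (i <= l <= M)%N ->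
  mbinom (1 - c - M%:R) l * (ebasis M i).[- l%:R]
  = rising c M * mbinom (1 - c) (l - i).
Proof.
case/andP=> il lM; rewrite horner_ebasis rising_neg_nat il /mbinom.
have [r rE] : exists r, r = (l - i)%N by exists (l - i)%N.
rewrite -rE; have lE : l%:R = i%:R + r%:R :> F by rewrite -natrD rE subnKC.
rewrite [rising (1 - c - _) l]rising_reflect [rising (1 - c) r]rising_reflect.
have -> : 1 - (1 - c - M%:R) - l%:R = c - r%:R + (M - i)%:R.
  by rewrite lE natrB; [ring | apply: leq_trans lM].
have -> : 1 - (1 - c) - r%:R = c - r%:R by ring.
have -> : - l%:R + c + i%:R = c - r%:R by rewrite lE; ring.
have E1 : rising (c - r%:R) (M - i) * rising (c - r%:R + (M - i)%:R) l
   = rising (c - r%:R) r * rising c M.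
  have -> : c = c - r%:R + r%:R by ring.
  by rewrite addrK -!risingD; congr (rising _ _); lia.
have -> : (-1) ^+ r = (-1) ^+ i * (-1) ^+ l :> F.
  rewrite -signr_odd -exprD -(signr_odd _ (i + l)); congr (_ ^+ _).
  by rewrite rE oddB // oddD addbC.
have := fact_neq0 F r; have := fact_neq0 F l.
move: E1; move: (rising (c - r%:R) (M - i)) (rising _ l) (rising _ r) => A B C E1.
move: l`!%:R r`!%:R ((-1) ^+ l) ((-1) ^+ i) => f g sl si f0 g0.
have -> : sl * B / f * (si * (f / g) * A) = si * sl / g * (A * B) by field; rewrite f0 g0.
by rewrite E1; field; rewrite g0.
Qed.

(** For [k < i] every node [- l] with [l <= k] is a zero of [ebasis M i]. Otherwise the nonzero
    terms form a Vandermonde sum for [(1 - c) + (c - 1) = 0], and [mbinom 0 (k - i)] is 1 for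
    [k = i] and 0 for [k > i]. *)
Lemma ecoef_ebasis M i k : (i <= M)%N -> (k <= M)%N ->
  ecoef M (ebasis M i) k = if k == i then rising c M else 0.
Proof.
move=> iM kM; rewrite /ecoef.
have [ki|ik] := ltnP k i.
  rewrite big1 => [|l _]; first by rewrite ltn_eqF.
  rewrite horner_ebasis rising_neg_nat leqNgt (leq_trans _ ki) ?ltn_ord //=.
  by rewrite mul0r mulr0.
have -> : k.+1 = (i + (k - i).+1)%N by lia.
rewrite big_split_ord /= big1 ?add0r => [|l _]; last first.
  by rewrite horner_ebasis rising_neg_nat leqNgt ltn_ord /= mul0r mulr0.
transitivity (rising c M * \sum_(l < (k - i).+1) mbinom (1 - c) l * mbinom (c - 1) (k - i - l)).
  rewrite mulr_sumr; apply: eq_bigr => l _; have := ltn_ord l => lk.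
  rewrite -mulrA ecoef_term; last by apply/andP; split; lia.
  by rewrite addKn subnDA mulrC mulrA.
rewrite mbinom_vandermonde addrA subrK subrr /mbinom.
have [->|neq] := eqVneq k i; first by rewrite subnn rising0 divr1 mulr1.
have -> : (k - i = (k - i).-1.+1)%N by lia.
by rewrite risingSl !mul0r mulr0.
Qed.

(** By [ecoef_ebasis] the matrix [E] of values and the matrix [A] of [ecoef] satisfy
    [E *m A = (rising c M)%:M], so they also do in the other order. That second identity says that
    both sides agree at [0, -1, ..., -M], which is more points than the degree allows for a nonzero
    difference. *)
Lemma ebasis_expansion M G : (size G <= M.+1)%N ->
  \sum_(k < M.+1) ecoef M G k *: ebasis M k = rising c M *: G.
Proof.
move=> sG.
pose E := \matrix_(i < M.+1, l < M.+1) (ebasis M i).[- (l : nat)%:R] : 'M[F]_M.+1.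
pose A := \matrix_(l < M.+1, k < M.+1) (if (l <= k)%N then
  mbinom (c - 1) (k - l) * mbinom (1 - c - M%:R) l else 0) : 'M[F]_M.+1.
have ecoefA H (k : 'I_M.+1) : ecoef M H k = \sum_(l < M.+1) H.[- (l : nat)%:R] * A l k.
  rewrite /ecoef (big_ord_widen M.+1 (fun l => mbinom (c - 1) (k - l)
    * mbinom (1 - c - M%:R) l * H.[- l%:R])) // big_mkcond /=; apply: eq_bigr => l _.
  by rewrite mxE ltnS; case: ifP => _; rewrite ?mulr0 // mulrC.
have EA : E *m A = (rising c M)%:M.
  apply/matrixP => i k; rewrite !mxE.
  transitivity (ecoef M (ebasis M i) k).
    by rewrite ecoefA; apply: eq_bigr => l _; rewrite !mxE.
  by rewrite ecoef_ebasis ?leq_ord // eq_sym -val_eqE /=; case: ifP.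
have r0 : rising c M != 0 by rewrite rising_neq0.
have AE : A *m E = (rising c M)%:M.
  have /mulmx1C : E *m ((rising c M)^-1 *: A) = 1%:M.
    by rewrite -scalemxAr EA scale_scalar_mx mulVf.
  rewrite -scalemxAl => /(congr1 (fun B => rising c M *: B)).
  by rewrite scalerA mulfV // scale1r scale_scalar_mx mulr1.
apply/eqP; rewrite -subr_eq0; set D := _ - _.
have sD : (size D <= M.+1)%N.
  rewrite (leq_trans (size_polyD _ _)) // geq_max size_polyN.
  rewrite (leq_trans (size_scale_leq _ _)) // andbT.
  apply: (leq_trans (size_sum _ _ _)); apply/bigmax_leqP => k _.
  by rewrite (leq_trans (size_scale_leq _ _)) // size_ebasis // leq_ord.
apply/negPn/negP => D0.
pose rs := [seq - (nat_of_ord l)%:R : F | l <- enum 'I_M.+1].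
have : (size rs < size D)%N.
  apply: max_poly_roots => //; last first.
    rewrite map_inj_uniq ?enum_uniq // => x y /oppr_inj /eqP.
    by rewrite eqr_nat => /eqP /val_inj.
  apply/allP => _ /mapP[l _ ->]; rewrite /root /D hornerD hornerN hornerZ horner_sum.
  rewrite subr_eq0; apply/eqP.
  under eq_bigr => k _ do rewrite hornerZ ecoefA mulr_suml.
  rewrite exchange_big /=.
  transitivity (\sum_(j < M.+1) G.[- (j : nat)%:R] * (A *m E) j l).
    apply: eq_bigr => j _; rewrite mxE mulr_sumr; apply: eq_bigr => k _.
    by rewrite mulrA [E _ _]mxE.
  rewrite AE (bigD1 l) //= big1 ?addr0 => [|j jl]; first by rewrite !mxE eqxx mulrC.
  by rewrite !mxE (negPf jl) mulr0.
by rewrite size_map -cardE card_ord ltnNge sD.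
Qed.

(** This is [ebasis_expansion] evaluated at [x + b] and divided by [rising (x + b + c) M]. It is the
    source of the Pade property: the sum vanishes whenever [x + b] is a root of [G]. *)
Lemma ecoef_convolution M G x b : 0 < x -> (size G <= M.+1)%N ->
  \sum_(k < M.+1) ecoef M G k * (rising x (k + b) / rising (x + c) (k + b))
  = rising x b / rising (x + c) b * (rising c M * G.[x + b%:R] / rising (x + b%:R + c) M).
Proof.
move=> x0 sG; set y := x + b%:R; have y0 : 0 < y by rewrite ltr_wpDr.
have r0 n z : 0 < z -> rising (z + c) n != 0 by move=> z0; rewrite rising_neq0 // addr_gt0.
have /(congr1 (horner^~ y)) := ebasis_expansion sG.
rewrite hornerZ => <-; rewrite horner_sum mulr_suml mulr_sumr; apply: eq_bigr => k _.
rewrite hornerZ horner_ebasis ![(k + b)%N]addnC !risingD -/y.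
have -> : x + c + b%:R = y + c by rewrite /y; ring.
have kM : (k <= M)%N by rewrite leq_ord.
have -> : rising (y + c) M = rising (y + c) k * rising (y + c + k%:R) (M - k).
  by rewrite -risingD subnKC.
have := r0 b x x0; have := r0 k y y0.
have h : 0 < y + c + k%:R by rewrite ltr_wpDr // addr_gt0.
have := rising_neq0 (M - k) h => h1 h2 h3.
by field; rewrite h1 h2 h3.
Qed.

End Interpolation.

(** * Nonvanishing *)

Section Nonvanishing.
Variables (F : numFieldType) (c a : F) (m : nat) (x : 'I_m -> F) (l : 'I_m -> F).
Variable w : nat -> F.
Hypotheses (c_gt0 : 0 < c) (a_neq0 : a != 0) (x_gt0 : forall j, 0 < x j).
Hypothesis x_sep : forall i j (b b' : nat), x i + b%:R = x j + b'%:R -> i = j.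
Hypothesis wS : forall k, w k.+1 = w k
  + a ^+ k * \sum_j l j * (rising (x j) k / rising (x j + c) k).
Implicit Types (G H : {poly F}) (M N k : nat).

Definition relform M G := \sum_(k < M.+1) ecoef c M G k * (a ^+ (M - k) * w k).

Lemma relformD M G H : relform M (G + H) = relform M G + relform M H.
Proof. by rewrite -big_split; apply: eq_bigr => k _; rewrite ecoefD mulrDl. Qed.

Lemma relformZ M b G : relform M (b *: G) = b * relform M G.
Proof. by rewrite /relform mulr_sumr; apply: eq_bigr => k _; rewrite ecoefZ -mulrA. Qed.

Lemma relform0 M : relform M 0 = 0.
Proof. by rewrite -[X in relform _ X](scale0r 0) relformZ mul0r. Qed.

Lemma relform_sum M (I : Type) (s : seq I) (f : I -> {poly F}) :
  relform M (\sum_(i <- s) f i) = \sum_(i <- s) relform M (f i).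
Proof. exact: (big_morph (relform M) (relformD M) (relform0 M)). Qed.

Lemma relform_ebasis M k : (k <= M)%N ->
  relform M (ebasis c M k) = rising c M * (a ^+ (M - k) * w k).
Proof.
move=> kM; rewrite /relform.
have kM1 : (k < M.+1)%N by [].
rewrite (bigD1 (Ordinal kM1)) //= big1 => [|i /negPf ik].
  by rewrite ecoef_ebasis // eqxx addr0.
by rewrite ecoef_ebasis ?leq_ord // -(inj_eq val_inj) in ik *; rewrite ik mul0r.
Qed.

Definition shiftX G := 'X * (G \Po ('X + 1%:P)).

Lemma horner_shiftX G z : (shiftX G).[z] = z * G.[z + 1].
Proof. by rewrite /shiftX hornerM hornerX horner_comp hornerD hornerX hornerC. Qed.

(** Both [shiftX] and multiplication by ['X + (c + M)] (in [mulX_ebasis]) map the basis of level [M]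
    into that of level [M.+1], the first raising the index and the second keeping it. Their
    comparison therefore produces the differences [w k.+1 - w k]. *)
Lemma shiftX_ebasis M k : (k <= M)%N -> shiftX (ebasis c M k) = ebasis c M.+1 k.+1.
Proof.
move=> kM; rewrite /shiftX /ebasis comp_polyM !rmorph_prod /= big_ord_recl addr0 mulrA.
congr (_ * _ * _); apply: eq_bigr => t _; rewrite rmorphD /= comp_polyX comp_polyC -addrA.
  by rewrite -polyCD /bump leq0n natrD.
rewrite -polyCD; congr (_ + _%:P); rewrite -natr1; ring.
Qed.

Lemma mulX_ebasis M k : (k <= M)%N ->
  ('X + (c + M%:R)%:P) * ebasis c M k = ebasis c M.+1 k.
Proof.
move=> kM; rewrite /ebasis mulrCA; congr (_ * _); rewrite subSn // big_ord_recr mulrC.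
congr (_ * ('X + _%:P)) => /=; rewrite -addrA -natrD subnKC //.
Qed.

Lemma relform_shiftX M G : (size G <= M.+1)%N -> rising c M * relform M.+1 (shiftX G)
  = rising c M.+1 * \sum_(k < M.+1) ecoef c M G k * (a ^+ (M - k) * w k.+1).
Proof.
move=> sG; rewrite -relformZ.
have -> : rising c M *: shiftX G = shiftX (rising c M *: G).
  by rewrite /shiftX comp_polyZ scalerAr.
rewrite -(ebasis_expansion c_gt0 sG) /shiftX raddf_sum mulr_sumr relform_sum mulr_sumr.
apply: eq_bigr => k _ /=; rewrite comp_polyZ -scalerAr relformZ -/(shiftX _).
have kM := leq_ord k; rewrite shiftX_ebasis // relform_ebasis // subSS; ring.
Qed.

Lemma relform_mulX M G : (size G <= M.+1)%N ->
  rising c M * relform M.+1 (('X + (c + M%:R)%:P) * G)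
  = rising c M.+1 * \sum_(k < M.+1) ecoef c M G k * (a ^+ (M - k).+1 * w k).
Proof.
move=> sG; rewrite -relformZ scalerAr -(ebasis_expansion c_gt0 sG).
rewrite mulr_sumr relform_sum mulr_sumr.
apply: eq_bigr => k _; rewrite -scalerAr relformZ.
have kM := leq_ord k; rewrite mulX_ebasis // relform_ebasis ?leqW // subSn //; ring.
Qed.

(** By [relform_shiftX] and [relform_mulX] the left side is a combination of
    [a ^+ (M.+1 - k) * (w k.+1 - w k)]. The recurrence [wS] turns the power of [a] into [a ^+ M.+1],
    free of [k], and the remaining sums over [k] are evaluated by [ecoef_convolution] with
    [b = 0]. *)
Lemma relform_equation M G : (size G <= M.+1)%N ->
  a * relform M.+1 (shiftX G) - relform M.+1 (('X + (c + M%:R)%:P) * G)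
  = rising c M.+1 * a ^+ M.+1 * \sum_j l j * (G.[x j] / rising (x j + c) M).
Proof.
move=> sG; have r0 : rising c M != 0 by rewrite rising_neq0.
apply: (mulfI r0); rewrite mulrBr mulrCA relform_shiftX // relform_mulX //.
set S1 := \sum_(k < _) _; set S2 := \sum_(k < _) _; set T := \sum_j _.
suff E : a * S1 - S2 = a ^+ M.+1 * (rising c M * T).
  by transitivity (rising c M.+1 * (a * S1 - S2)); [ring | rewrite E; ring].
rewrite mulr_sumr -sumrB.
transitivity (a ^+ M.+1 * \sum_(k < M.+1) \sum_j l j *
    (ecoef c M G k * (rising (x j) k / rising (x j + c) k))).
  rewrite mulr_sumr; apply: eq_bigr => k _; rewrite wS exprS.
  have -> : a ^+ M.+1 = a * a ^+ (M - k) * a ^+ k.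
    by rewrite -exprS -exprD; congr (_ ^+ _); have := ltn_ord k; lia.
  under [in RHS]eq_bigr => j _ do rewrite mulrCA.
  by rewrite -mulr_sumr; ring.
rewrite exchange_big; congr (_ * _); rewrite mulr_sumr; apply: eq_bigr => j _.
rewrite -mulr_sumr mulrCA; congr (_ * _).
have := ecoef_convolution c_gt0 0 (x_gt0 j) sG.
rewrite !rising0 addr0 divr1 mul1r mulrA => <-; apply: eq_bigr => k _.
by rewrite addn0.
Qed.

Definition pts N := [seq x j + b%:R | j <- enum 'I_m, b <- iota 0 N].
Definition ptpoly N : {poly F} := \prod_(z <- pts N) ('X - z%:P).

Lemma ptsP N z : reflect (exists j, exists2 b, (b < N)%N & z = x j + b%:R) (z \in pts N).
Proof.
apply: (iffP allpairsP) => [[[j b] [_ /= bN ->]]|[j [b bN ->]]].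
  by exists j, b => //; move: bN; rewrite mem_iota.
by exists (j, b); rewrite /= mem_enum mem_iota.
Qed.

Lemma mem_pts N j b : (x j + b%:R \in pts N) = (b < N)%N.
Proof.
apply/ptsP/idP => [[i [b' b'N E]]|bN]; last by exists j, b.
have ij := x_sep E; move: E; rewrite ij => /addrI/eqP; rewrite eqr_nat => /eqP ->; exact: b'N.
Qed.

Lemma size_pts N : size (pts N) = (m * N)%N.
Proof. by rewrite size_allpairs size_iota -cardE card_ord. Qed.

Lemma uniq_pts N : uniq (pts N).
Proof.
apply: allpairs_uniq; rewrite ?enum_uniq ?iota_uniq // => -[i b] [j b'] _ _ /= E.
have ij := x_sep E; move: E; rewrite ij => /addrI/eqP; rewrite eqr_nat => /eqP -> //.
Qed.

Lemma ptpoly_neq0 N : ptpoly N != 0.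
Proof. by rewrite monic_neq0 // monic_prod_XsubC. Qed.

Lemma dvd_ptpoly N G : (forall j b, (b < N)%N -> G.[x j + b%:R] = 0) -> ptpoly N %| G.
Proof.
move=> G0; apply: uniq_roots_dvdp; last by rewrite uniq_rootsE uniq_pts.
by apply/allP => _ /ptsP[j [b bN ->]]; apply/rootP/G0.
Qed.

(** The Lagrange polynomial of the node [x j + b], without normalisation. *)
Definition lagpoly N j b : {poly F} :=
  \prod_(z <- rem (x j + b%:R) (pts N)) ('X - z%:P).

Lemma lagpoly_eq0 N j b i d : ((lagpoly N j b).[x i + d%:R] == 0)
  = (d < N)%N && ~~ ((i == j) && (d == b)).
Proof.
rewrite -[LHS]/(root _ _) root_prod_XsubC mem_rem_uniq ?uniq_pts // inE mem_pts andbC.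
congr (_ && ~~ _); apply/eqP/andP => [E|[/eqP-> /eqP->//]].
have ij := x_sep E; move: E; rewrite ij eqxx => /addrI/eqP; rewrite eqr_nat; done.
Qed.

Lemma size_lagpoly N j b : (b < N)%N -> size (lagpoly N j b) = (m * N)%N.
Proof.
move=> bN; rewrite size_prod_XsubC size_rem ?mem_pts // size_pts prednK //.
by rewrite muln_gt0 (leq_ltn_trans _ bN) // andbT (leq_ltn_trans _ (ltn_ord j)).
Qed.

Section Vanishing.
Variable N : nat.
Hypothesis m_gt0 : (0 < m)%N.
Let M := (m * N.+1)%N.
Hypothesis vanish : forall i, (i <= m)%N -> relform M ('X^i * ptpoly N) = 0.

(** Since [ptpoly N] has degree [m * N = M - m], the cofactor has degree at most [m], and [G] is a
    combination of the polynomials in [vanish]. *)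
Lemma relform_dvd G : (size G <= M.+1)%N -> ptpoly N %| G -> relform M G = 0.
Proof.
move=> sG /dvdpP[H GE]; have [H0|H0] := eqVneq H 0.
  by rewrite GE H0 mul0r relform0.
have sH : (size H <= m.+1)%N.
  move: sG; rewrite GE size_mul ?ptpoly_neq0 // size_prod_XsubC size_pts addnS /=.
  by rewrite /M mulnS -addSn leq_add2r.
have -> : G = \sum_(i < m.+1) H`_i *: ('X^i * ptpoly N).
  rewrite GE {1}(_ : H = \sum_(i < m.+1) H`_i *: 'X^i) ?mulr_suml.
    by apply: eq_bigr => i _; rewrite scalerAl.
  rewrite -poly_def; apply/polyP => i; rewrite coef_poly.
  by case: ltnP => // im; rewrite nth_default // (leq_trans sH).
by rewrite relform_sum big1 // => i _; rewrite relformZ vanish ?mulr0 // leq_ord.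
Qed.

Lemma shiftX_lagpoly_eq0 j b i d : ((shiftX (lagpoly N.+1 j b)).[x i + d%:R] == 0)
  = (d < N)%N && ~~ ((i == j) && (d.+1 == b)).
Proof.
rewrite horner_shiftX mulf_eq0 gt_eqF ?ltr_wpDr //= -addrA natr1 lagpoly_eq0.
by rewrite ltnS.
Qed.

Lemma size_shiftX G : (size (shiftX G) <= (size G).+1)%N.
Proof.
rewrite /shiftX mulrC; have [->|G0] := eqVneq (G \Po ('X + 1%:P)) 0.
  by rewrite mul0r size_poly0.
by rewrite size_mulX // size_comp_poly2 // size_XaddC.
Qed.

Let M_gt0 : (0 < M)%N. Proof. by rewrite /M muln_gt0 m_gt0. Qed.

(* Downward induction on the distance from [b] to the last node: the functional
   equation applied to the Lagrange polynomial of the node [b + 1] kills the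
   evaluation at the node [b]. *)
Lemma relform_vanish_step r b j G : (b + r = N)%N -> (size G <= M.+1)%N ->
  (forall i d, (d < N)%N -> ~~ ((i == j) && (d == b)) -> G.[x i + d%:R] = 0) ->
  relform M G = 0.
Proof.
elim: r b G => [|r IH] b G brN sG G0.
  apply: relform_dvd => //; apply: dvd_ptpoly => i d dN; apply: G0 => //.
  by move: dN; rewrite -[X in (_ < X)%N]brN addn0 => db; rewrite negb_and (ltn_eqF db) orbT.
have bN : (b < N)%N by lia.
pose H := lagpoly N.+1 j b.+1.
have sH : size H = M.-1.+1 by rewrite prednK // size_lagpoly.
have eqH := relform_equation (eq_leq sH); move: eqH; rewrite prednK //.
(* The right side of the functional equation only involves the nodes [x i + 0]. There [H] vanishes,
   because the node it omits is [x j + b.+1]. *)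
rewrite big1 ?mulr0 => [|i _]; last first.
  have /eqP : (H.[x i + 0%:R] == 0) by rewrite /H lagpoly_eq0 andbF.
  by rewrite addr0 => ->; rewrite mul0r mulr0.
rewrite (IH b.+1 (('X + (c + M.-1%:R)%:P) * H)) ?subr0; first last.
- move=> i d dN ne; apply/eqP; rewrite hornerM mulf_eq0 /H lagpoly_eq0 ltnS (ltnW dN) ne.
  by rewrite orbT.
- rewrite (leq_trans (size_polyMleq _ _)) // size_XaddC sH prednK //.
- lia.
move=> /eqP; rewrite mulf_eq0 (negPf a_neq0) => /eqP S0.
have Hj : (shiftX H).[x j + b%:R] != 0 by rewrite /H shiftX_lagpoly_eq0 !eqxx andbF.
(* Among the nodes with index below [N], [shiftX H] is nonzero only at [x j + b]. Subtracting this
   multiple of it from [G] leaves a multiple of [ptpoly N]. *)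
pose k := G.[x j + b%:R] / (shiftX H).[x j + b%:R].
have -> : G = k *: shiftX H + (G - k *: shiftX H) by rewrite addrC subrK.
have sS : (size (shiftX H) <= M.+1)%N.
  by rewrite (leq_trans (size_shiftX _)) // sH prednK.
rewrite relformD relformZ S0 mulr0 add0r; apply: relform_dvd.
  rewrite (leq_trans (size_polyD _ _)) // geq_max sG size_polyN.
  by rewrite (leq_trans (size_scale_leq _ _)).
apply: dvd_ptpoly => i d dN; rewrite hornerD hornerN hornerZ.
have [/andP[/eqP-> /eqP->]|ne] := boolP ((i == j) && (d == b)).
  by rewrite /k divfK // subrr.
rewrite G0 //; have /eqP -> : (shiftX H).[x i + d%:R] == 0.
  by rewrite /H shiftX_lagpoly_eq0 dN eqSS.
by rewrite mulr0 subrr.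
Qed.

(** For [H] omitting the node [x j], [shiftX H] vanishes at all nodes below [N], and
    [relform_vanish_step] with [b = 0] handles the other polynomial. So the left side of the
    functional equation is zero, while the right side is a nonzero multiple of [l j]. *)
Lemma relform_vanish j : l j = 0.
Proof.
pose H := lagpoly N.+1 j 0.
have sH : size H = M.-1.+1 by rewrite prednK // size_lagpoly.
have eqH := relform_equation (eq_leq sH); move: eqH; rewrite prednK //.
rewrite (relform_dvd (G := shiftX H)); first last.
- by apply: dvd_ptpoly => i d dN; apply/eqP; rewrite /H shiftX_lagpoly_eq0 dN andbF.
- by rewrite (leq_trans (size_shiftX _)) // sH prednK.
rewrite (@relform_vanish_step N 0 j); first last.
- move=> i d dN ne; apply/eqP; rewrite hornerM mulf_eq0 /H lagpoly_eq0 ltnS (ltnW dN) ne.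
  by rewrite orbT.
- by rewrite (leq_trans (size_polyMleq _ _)) // size_XaddC sH prednK.
- by [].
rewrite mulr0 subrr (bigD1 j) //= big1 ?addr0 => [|i ij]; last first.
  have /eqP : (H.[x i + 0%:R] == 0) by rewrite /H lagpoly_eq0 (negPf ij).
  by rewrite addr0 => ->; rewrite mul0r mulr0.
have Hj : H.[x j] != 0.
  by have := lagpoly_eq0 N.+1 j 0 j 0; rewrite addr0 !eqxx => ->.
move=> /esym/eqP; rewrite !mulf_eq0 invr_eq0 expf_eq0 (negPf a_neq0) (negPf Hj) andbF.
by rewrite !(negPf (rising_neq0 _ _)) ?addr_gt0 //= !orbF => /eqP.
Qed.

End Vanishing.
End Nonvanishing.

(** * Divisibility and integrality *)

Section FactorialDivides.
Implicit Types (r : int) (s k n p : nat).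

Lemma logn_fact_le p n : prime p -> (logn p n`! <= n)%N.
Proof.
move=> pr; rewrite logn_fact //.
(* The extra summand makes the induction work: [2 * (n %/ p ^ K.+1) <= n %/ p ^ K]. *)
suff H K : (\sum_(1 <= j < K.+1) n %/ p ^ j + n %/ p ^ K <= n)%N.
  exact: leq_trans (leq_addr _ _) (H n).
elim: K => [|K IH]; first by rewrite big_geq // expn0 divn1.
rewrite big_nat_recr //= -addnA; apply: leq_trans IH; rewrite leq_add2l addnn -muln2.
rewrite expnSr divnMA; apply: leq_trans (leq_divM (n %/ p ^ K) p).
by rewrite leq_mul2l prime_gt1 ?orbT.
Qed.

Lemma fact_dvd_pochn y k : (k`! %| \prod_(t < k) (y + t))%N.
Proof.
case: y => [|y]; last first.
  have -> : (\prod_(t < k) (y.+1 + t) = (y + k) ^_ k)%N.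
    rewrite ffact_prod (reindex_inj rev_ord_inj) /=; apply: eq_bigr => t _.
    by have := ltn_ord t; lia.
  by rewrite -bin_ffact dvdn_mull.
by case: k => // k; rewrite big_ord_recl mul0n dvdn0.
Qed.

(** As [s] is invertible modulo [A], there is a natural [y] with [r = s y] modulo [A]. The product
    is then congruent to [s ^ k] times [k] consecutive naturals. *)
Lemma coprime_dvd_arith_prod A r s k : (A %| k`!)%N -> coprime A s ->
  (A%:Z %| \prod_(t < k) (r + t%:Z * s%:Z))%Z.
Proof.
move=> Ak cAs; have A0 : A%:Z != 0.
  by rewrite eqz_nat -lt0n (dvdn_gt0 (fact_gt0 k)).
have [g [h]] := Bezoutz A s; have /eqP -> : coprimez A s by [].
move=> gh; pose y := `|((r * h) %% A)%Z|%N.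
have yE : y%:Z = r * h - ((r * h) %/ A)%Z * A by rewrite abszE ger0_norm ?modz_ge0.
have rE : (A%:Z %| r - s%:Z * y%:Z)%Z.
  apply/dvdzP; exists (r * g + s%:Z * ((r * h) %/ A)%Z).
  by rewrite yE -{1}[r]mulr1 -gh; ring.
have modE n : (A%:Z %| \prod_(t < n) (r + t%:Z * s%:Z)
    - s%:Z ^+ n * (\prod_(t < n) (y + t)%N)%:Z)%Z.
  elim: n => [|n IH]; first by rewrite !big_ord0.
  rewrite !big_ord_recr /= PoszM PoszD exprS.
  set P := \prod_(i < n) _; set Q := (\prod_(i < n) _)%:Z.
  have -> : P * (r + n%:Z * s%:Z) - s%:Z * s%:Z ^+ n * (Q * (y%:Z + n%:Z))
    = (P - s%:Z ^+ n * Q) * (r + n%:Z * s%:Z) + s%:Z ^+ n * Q * (r - s%:Z * y%:Z) by ring.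
  by apply: rpredD; [apply: dvdz_mulr | apply: dvdz_mull].
rewrite -[X in (_ %| X)%Z](subrK (s%:Z ^+ k * (\prod_(t < k) (y + t)%N)%:Z)).
apply: rpredD; first exact: modE.
apply: dvdz_mull; rewrite dvdzE /=; exact: dvdn_trans Ak (fact_dvd_pochn _ _).
Qed.

(** Split the factorial according to the primes dividing [s]. Such a prime occurs in it at most [k]
    times, so [s ^ k] absorbs that part; the complementary part is coprime to [s]. *)
Lemma fact_dvd_arith_prod r s k : (0 < s)%N ->
  (k`!%:Z %| s%:Z ^+ k * \prod_(t < k) (r + t%:Z * s%:Z))%Z.
Proof.
move=> s0; pose pi := \pi(s).
rewrite -(partnC pi (fact_gt0 k)) PoszM.
have cop : coprime (k`!)`_pi (k`!)`_pi^' by apply: coprime_partC.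
have copz : coprimez ((k`!)`_pi)%N ((k`!)`_pi^')%N by [].
rewrite Gauss_dvdz //; apply/andP; split.
  apply: dvdz_mulr; rewrite dvdzE abszX /=.
  apply/dvdn_partP => [|p]; first exact: part_gt0.
  rewrite pi_of_part ?fact_gt0 // inE => /andP[_ ps].
  have pr : prime p by move: ps; rewrite mem_primes => /andP[].
  have pds : (p %| s)%N by move: ps; rewrite mem_primes => /and3P[].
  rewrite p_part; apply: dvdn_trans (dvdn_exp2r k pds); apply: dvdn_exp2l.
  apply: leq_trans (logn_fact_le k pr).
  exact: dvdn_leq_log (fact_gt0 _) (dvdn_part _ _).
apply: dvdz_mull; apply: coprime_dvd_arith_prod; first exact: dvdn_part.
by rewrite coprime_sym; apply: (@pnat_coprime pi); [apply: pnat_pi | apply: part_pnat].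
Qed.

End FactorialDivides.

(** * An elementary Chebyshev bound for the least common multiple of [1, ..., n] *)

Section LcmUpto.
Implicit Types (i k n p : nat).

Definition lcmupto n := \big[lcmn/1%N]_(i < n) i.+1.

Lemma dvdn_lcmupto n i : (0 < i <= n)%N -> (i %| lcmupto n)%N.
Proof.
case/andP=> i0 iln; have iP : (i.-1 < n)%N by rewrite prednK.
by rewrite -[i in (i %| _)%N](prednK i0); apply: (biglcmn_sup (Ordinal iP)).
Qed.

Lemma lcmupto_dvd n k : (forall i, (0 < i <= n)%N -> (i %| k)%N) -> (lcmupto n %| k)%N.
Proof. by move=> H; apply/dvdn_biglcmP => i _; apply: H; rewrite /= ltn_ord. Qed.

Lemma lcmupto_gt0 n : (0 < lcmupto n)%N.
Proof. by rewrite (@dvdn_gt0 _ n`!) ?fact_gt0 ?lcmupto_dvd // => i; apply: dvdn_fact. Qed.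

(** Legendre's formula compared term by term: no term of the denominator exceeds that of the
    numerator, and at [p ^ e] the inequality is strict. *)
Lemma prime_dvd_bin p e n k : prime p -> (k < p ^ e <= n)%N -> (k <= n)%N -> (n - k < p ^ e)%N ->
  (p %| 'C(n, k))%N.
Proof.
move=> pr /andP[ke en] kn nke.
have C0 : (0 < 'C(n, k))%N by rewrite bin_gt0.
have e_le : (e < n.+1)%N by rewrite ltnS (leq_trans _ en) // ltnW // ltn_expl // prime_gt1.
have e_gt : (0 < e)%N by move: ke nke en; case: e e_le => //=; rewrite expn0; lia.
have : (logn p (k`! * (n - k)`!) < logn p n`!)%N.
  rewrite lognM ?fact_gt0 // !logn_fact //.
  have widen q : (q <= n)%N ->
      (\sum_(1 <= j < q.+1) q %/ p ^ j = \sum_(1 <= j < n.+1) q %/ p ^ j)%N.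
    move=> qn; rewrite [RHS](@big_cat_nat _ _ _ q.+1) //= [X in (_ + X)%N]big_nat_cond.
    rewrite [X in (_ + X)%N]big1 ?addn0 // => j; rewrite andbT => /andP[qj _]; rewrite divn_small //.
    by rewrite (leq_trans qj) // ltnW // ltn_expl // prime_gt1.
  rewrite (widen k) // (widen (n - k)%N) ?leq_subr // -big_split /=.
  rewrite [X in (X < _)%N](@big_cat_nat _ _ _ e) ?(ltnW e_le) //=.
  rewrite [X in (_ < X)%N](@big_cat_nat _ _ _ e) ?(ltnW e_le) //=.
  have le j : (k %/ p ^ j + (n - k) %/ p ^ j <= n %/ p ^ j)%N.
    by rewrite -[in leqRHS](subnKC kn) divnD ?expn_gt0 ?prime_gt0 // leq_addr.
  rewrite -addnS leq_add //; first by apply: leq_sum.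
  rewrite (big_ltn e_le) [X in (_ < X)%N](big_ltn e_le) -addSn leq_add //.
    by rewrite (divn_small ke) (divn_small nke) divn_gt0 // expn_gt0 prime_gt0.
  by apply: leq_sum.
rewrite -(bin_fact kn) (lognM p C0) ?muln_gt0 ?fact_gt0 // -[X in (X < _)%N]add0n ltn_add2r.
by rewrite logn_gt0 mem_primes => /and3P[].
Qed.

(** Take a prime power [p ^ e <= n]. If it exceeds [k], then it exceeds [n - k] too, so [p] divides
    the binomial coefficient, and [p ^ (e - 1) <= n / 2 <= k]. *)
Lemma lcmupto_bin n k : (k <= n <= k.*2)%N -> (lcmupto n %| 'C(n, k) * lcmupto k)%N.
Proof.
case/andP=> kn n2k; apply: lcmupto_dvd => i /andP[i0 iln].
apply/dvdn_partP => // p; rewrite mem_primes => /and3P[pr _ _].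
rewrite p_part; set e := logn p i.
have en : (p ^ e <= n)%N by rewrite (leq_trans _ iln) // dvdn_leq // pfactor_dvdnn.
have pe0 : (0 < p ^ e)%N by rewrite expn_gt0 prime_gt0.
have [ek|ke] := leqP (p ^ e) k.
  by rewrite dvdn_mull // dvdn_lcmupto // pe0.
case: e en pe0 ke => [|e] en pe0 ke; first by rewrite expn0 dvd1n.
rewrite expnS dvdn_mul //; first by apply: (@prime_dvd_bin p e.+1); rewrite ?ke //; lia.
rewrite dvdn_lcmupto // expn_gt0 prime_gt0 //=.
have := leq_mul (prime_gt1 pr) (leqnn (p ^ e)); rewrite -expnS.
move: en; lia.
Qed.

Lemma bin_le_exp2 n k : ('C(n, k) <= 2 ^ n)%N.
Proof.
have [kn|kn] := leqP k n; last by rewrite bin_small.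
rewrite -[2%N]/(1 + 1)%N expnDn (bigD1 (Ordinal (kn : (k < n.+1)%N))) //=.
by rewrite !exp1n !muln1 leq_addr.
Qed.

(** Two equal entries of a row whose sum is [2 * 4 ^ k]. *)
Lemma bin_odd_le k : ('C(k.*2.+1, k.+1) <= 4 ^ k)%N.
Proof.
have E : 'C(k.*2.+1, k) = 'C(k.*2.+1, k.+1).
  by rewrite -bin_sub; [congr 'C(_, _); lia | lia].
have : ('C(k.*2.+1, k) + 'C(k.*2.+1, k.+1) <= 2 ^ k.*2.+1)%N.
  rewrite -[2%N]/(1 + 1)%N expnDn.
  have k1 : (k < k.*2.+2)%N by lia.
  have k2 : (k.+1 < k.*2.+2)%N by lia.
  rewrite (bigD1 (Ordinal k1)) //= (bigD1 (Ordinal k2)) //=; last first.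
    by rewrite -val_eqE /= gtn_eqF.
  by rewrite !exp1n !muln1 addnA leq_addr.
by rewrite E addnn expnS mul2n leq_double -mul2n expnM.
Qed.

(** Strong induction through [lcmupto_bin], with [k] half of [n] rounded up. *)
Lemma lcmupto_le n : (lcmupto n <= 4 ^ n)%N.
Proof.
elim/ltn_ind: n => n IH.
have step k : (0 < n)%N -> (k < n)%N -> (k <= n <= k.*2)%N -> ('C(n, k) <= 4 ^ (n - k))%N ->
  (lcmupto n <= 4 ^ n)%N.
  move=> n0 kn nk C4.
  have := lcmupto_bin nk => /dvdn_leq; rewrite muln_gt0 bin_gt0 lcmupto_gt0 (ltnW kn).
  move=> /(_ isT) H; apply: (leq_trans H).
  by rewrite -[X in (_ <= 4 ^ X)%N](subnK (ltnW kn)) expnD leq_mul // IH.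
have [->|n0] := posnP n; first by rewrite /lcmupto big_ord0.
(* Here half of [n] rounded up is [n] itself, so [step] does not apply. *)
have [->|n1] := eqVneq n 1%N; first by rewrite /lcmupto big_ord1.
have [no|ne] := boolP (odd n).
  have nE : n = (n./2).*2.+1 by rewrite -[LHS]odd_double_half no.
  apply: (step n./2.+1) => //; try lia.
  have -> : (n - n./2.+1 = n./2)%N by lia.
  by rewrite {1}nE bin_odd_le.
have nE : n = (n./2).*2 by rewrite -[LHS]odd_double_half (negPf ne).
apply: (step n./2) => //; try lia.
have -> : (n - n./2 = n./2)%N by lia.
by rewrite {1}nE (leq_trans (bin_le_exp2 _ _)) // -mul2n expnM.
Qed.

End LcmUpto.

(** * Denominators of [mbinom] and of quotients of arithmetic products *)

Section Integrality.
Implicit Types (r : int) (s k n p u v d : nat).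

Definition arithprod r s n : int := \prod_(t < n) (r + t%:Z * s%:Z).

Lemma rising_frac r s n : (0 < s)%N ->
  rising (r%:~R / s%:R : rat) n = (arithprod r s n)%:~R / s%:R ^+ n.
Proof.
move=> s0; have sn : s%:R != 0 :> rat by rewrite pnatr_eq0 -lt0n.
elim: n => [|n IH]; first by rewrite rising0 /arithprod big_ord0 divr1.
rewrite risingSr IH /arithprod big_ord_recr /= exprS intrM intrD intrM.
by rewrite -!pmulrn; field; rewrite sn expf_neq0.
Qed.

Lemma dvdz_int_div (x y : int) : y != 0 -> (y %| x)%Z -> x%:~R / y%:~R \is a @Num.int rat.
Proof. by move=> y0 /dvdzP[q ->]; rewrite intrM mulfK ?intr_eq0 // intr_int. Qed.

(** One factor [s ^ n] clears the denominators of the rising factorial, the other makes the product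
    divisible by the factorial. *)
Lemma mbinom_frac_int r s n : (0 < s)%N ->
  s%:R ^+ n.*2 * mbinom (r%:~R / s%:R) n \is a @Num.int rat.
Proof.
move=> s0; have sn : s%:R != 0 :> rat by rewrite pnatr_eq0 -lt0n.
have f0 : n`!%:Z != 0 by rewrite eqz_nat -lt0n fact_gt0.
have := dvdz_int_div f0 (fact_dvd_arith_prod r n s0).
rewrite -/(arithprod r s n) intrM -!pmulrn /mbinom rising_frac // -addnn exprD rmorphXn /=.
congr (_ \is a _); have : s%:R ^+ n != 0 :> rat by rewrite expf_neq0.
have := fact_neq0 rat n; move: n`!%:R (arithprod r s n)%:~R => f g f0' s1.
by rewrite -pmulrn; field; rewrite f0' s1.
Qed.

(* Partial fractions: [i! v^i / prod_(t <= i) (u + t v)] is an integral combination of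
   the [1 / (u + t v)]. *)
Lemma partial_fraction_int i (u v L : rat) :
  (forall t, (t <= i)%N -> u + t%:R * v != 0) ->
  (forall t, (t <= i)%N -> L / (u + t%:R * v) \is a Num.int) ->
  L * i`!%:R * v ^+ i / \prod_(t < i.+1) (u + t%:R * v) \is a Num.int.
Proof.
elim: i u => [|i IH] u n0 intL.
  by rewrite fact0 expr0 !mulr1 big_ord_recl big_ord0 mulr1; apply: intL.
have shift t : u + v + t%:R * v = u + t.+1%:R * v by rewrite -natr1; ring.
have A : L * i`!%:R * v ^+ i / \prod_(t < i.+1) (u + t%:R * v) \is a Num.int.
  by apply: IH => t ti; [apply: n0 | apply: intL]; apply: leqW.
have B : L * i`!%:R * v ^+ i / \prod_(t < i.+1) (u + v + t%:R * v) \is a Num.int.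
  by apply: IH => t ti; rewrite shift; [apply: n0 | apply: intL].
(* Write [i.+1 * v = (u + i.+1 * v) - u]: each summand cancels one end factor of the product. *)
suff -> : L * i.+1`!%:R * v ^+ i.+1 / \prod_(t < i.+2) (u + t%:R * v)
  = L * i`!%:R * v ^+ i / \prod_(t < i.+1) (u + t%:R * v)
    - L * i`!%:R * v ^+ i / \prod_(t < i.+1) (u + v + t%:R * v) by apply: rpredB.
have EB : \prod_(t < i.+1) (u + v + t%:R * v) = \prod_(t < i) (u + t.+1%:R * v) * (u + i.+1%:R * v).
  by rewrite big_ord_recr /= shift; congr (_ * _); apply: eq_bigr => t _; rewrite shift.
rewrite EB big_ord_recl [in LHS]big_ord_recr [in RHS]big_ord_recl /= mul0r addr0 factS natrM exprS.
have := n0 0%N isT; rewrite mul0r addr0 => u0.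
have := n0 i.+1 (leqnn _).
have : \prod_(t < i) (u + t.+1%:R * v) != 0.
  by apply/prodf_neq0 => t _; apply: n0; rewrite ltnS ltnW.
move: (\prod_(t < i) _) i`!%:R (v ^+ i) i.+1%:R => P f w j P0 j0.
by field; rewrite P0 u0 j0.
Qed.

(** Partial fractions give the divisibility up to a power of [v], which is coprime to the
    product. *)
Lemma arith_prod_dvd_fact_lcm i (u v L : nat) : coprime u v -> (0 < u)%N ->
  (forall t, (t < i)%N -> (u + t * v %| L)%N) ->
  (\prod_(t < i) (u + t * v) %| i`! * L)%N.
Proof.
case: i => [|i] cuv u0 dL; first by rewrite big_ord0 dvd1n.
have P0 : (0 < \prod_(t < i.+1) (u + t * v))%N by apply: prodn_gt0 => t; lia.
have cop : coprime (\prod_(t < i.+1) (u + t * v)) (v ^ i).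
  apply/coprimeXr; rewrite coprime_sym; apply: (big_ind (coprime v)); first exact: coprimen1.
    by move=> x y cx cy; rewrite coprimeMr cx.
  by move=> t _; rewrite /coprime addnC gcdnMDl gcdnC.
have : L%:R * i`!%:R * v%:R ^+ i / \prod_(t < i.+1) (u%:R + t%:R * v%:R) \is a @Num.int rat.
  apply: partial_fraction_int => t ti.
    by rewrite -natrM -natrD pnatr_eq0; lia.
  rewrite -natrM -natrD; have /dvdnP[q ->] := dL t ti.
  rewrite natrM mulfK ?natr_int // pnatr_eq0; lia.
have -> : \prod_(t < i.+1) (u%:R + t%:R * v%:R) = (\prod_(t < i.+1) (u + t * v))%:R :> rat.
  by rewrite natr_prod; apply: eq_bigr => t _; rewrite natrD natrM.
rewrite -natrX -!natrM => /intrP[q qE].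
have : (L * i`! * v ^ i)%:Z = q * (\prod_(t < i.+1) (u + t * v))%:Z.
  apply/eqP; rewrite -(eqr_int rat) intrM -!pmulrn -qE divfK // pnatr_eq0; lia.
move=> /(congr1 absz); rewrite abszM /= => E.
have : (\prod_(t < i.+1) (u + t * v) %| L * i`! * v ^ i)%N by rewrite E dvdn_mull.
rewrite Gauss_dvdl // => H; apply: dvdn_trans H _; rewrite mulnC factS -mulnA dvdn_mull //.
Qed.

(** Multiplying by [v ^ i], which is coprime to the left side, turns [d ^ i] into [s0 ^ i * s ^ i];
    then [s ^ i] makes the product of the [r + t * s] divisible by the factorial of [i]. *)
Lemma arith_prod_dvd i (r s u v s0 d L : nat) : coprime u v -> (0 < u)%N -> (0 < s)%N ->
  (0 < v)%N -> (s0 * s = d * v)%N -> (forall t, (t < i)%N -> (u + t * v %| L)%N) ->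
  (\prod_(t < i) (u + t * v) %| d ^ i * (\prod_(t < i) (r + t * s)) * L)%N.
Proof.
move=> cuv u0 s_gt0 v0 sdv dL.
have cop : coprime (\prod_(t < i) (u + t * v)) (v ^ i).
  apply/coprimeXr; rewrite coprime_sym; apply: (big_ind (coprime v)); first exact: coprimen1.
    by move=> x y cx cy; rewrite coprimeMr cx.
  by move=> t _; rewrite /coprime addnC gcdnMDl gcdnC.
rewrite -(Gauss_dvdr _ cop); apply: dvdn_trans (arith_prod_dvd_fact_lcm cuv u0 dL) _.
rewrite mulnA dvdn_mul // mulnA -expnMn [(v * d)%N]mulnC -sdv expnMn -mulnA dvdn_mull //.
have := fact_dvd_arith_prod r i s_gt0; rewrite dvdzE abszM abszX /=.
rewrite (_ : \prod_(t < i) _ = (\prod_(t < i) (r + t * s))%N%:Z) //.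
by rewrite -[RHS]natz natr_prod; apply: eq_bigr => t _; rewrite natz.
Qed.

End Integrality.

(** * Rational numbers that are divisible by a given power of [p] *)

Section Small.
Variable p : nat.
Hypothesis p_prime : prime p.
Implicit Types (x y : rat) (e f : nat).

(** The counterpart of [padic_small] for [rat]; [psmall 0] expresses [p]-integrality. *)
Definition psmall e x := exists n w : int, ~~ (p%:Z %| w)%Z /\ x * w%:~R = (p%:Z ^+ e * n)%:~R.

Let Euclid (v w : int) : ~~ (p%:Z %| v)%Z -> ~~ (p%:Z %| w)%Z -> ~~ (p%:Z %| v * w)%Z.
Proof. by rewrite !dvdzE abszM Euclid_dvdM // negb_or => -> ->. Qed.

Lemma psmall_int (x : rat) : x \is a Num.int -> psmall 0 x.
Proof.
move=> /intrP[n ->]; exists n, 1; split; last by rewrite mulr1 mul1r.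
by rewrite dvdzE dvdn1 gtn_eqF // prime_gt1.
Qed.

Lemma psmallD e x y : psmall e x -> psmall e y -> psmall e (x + y).
Proof.
move=> [n [w [pw xw]]] [n' [w' [pw' yw']]]; exists (n * w' + n' * w), (w * w').
split; first exact: Euclid.
rewrite intrM mulrDl [y * _]mulrCA !mulrA xw -[_ * y * _]mulrA yw'.
by rewrite -intrM -intrM -intrD; congr (_%:~R); ring.
Qed.

Lemma psmallM e f x y : psmall e x -> psmall f y -> psmall (e + f) (x * y).
Proof.
move=> [n [w [pw xw]]] [n' [w' [pw' yw']]]; exists (n * n'), (w * w').
split; first exact: Euclid.
by rewrite intrM mulrACA xw yw' -intrM exprD; congr (_%:~R); ring.
Qed.

Lemma psmall0 e : psmall e 0.
Proof.
exists 0, 1; split; last by rewrite mul0r mulr0.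
by rewrite dvdzE dvdn1 gtn_eqF // prime_gt1.
Qed.

Lemma psmall_sum e (I : Type) (s : seq I) (P : pred I) (F : I -> rat) :
  (forall i, P i -> psmall e (F i)) -> psmall e (\sum_(i <- s | P i) F i).
Proof. by move=> H; apply: big_ind => //; [apply: psmall0 | apply: psmallD]. Qed.

Lemma psmallMint e x y : psmall e x -> y \is a Num.int -> psmall e (y * x).
Proof. by move=> sx /psmall_int sy; have := psmallM sy sx. Qed.

Lemma psmallX e x n : psmall e x -> psmall (e * n) (x ^+ n).
Proof.
move=> sx; elim: n => [|n IH]; first by rewrite muln0 expr0; apply/psmall_int/rpred1.
by rewrite exprS mulnS; apply: psmallM.
Qed.

Lemma psmall_dvd e (n : int) : (p%:Z ^+ e %| n)%Z -> psmall e n%:~R.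
Proof.
move=> /dvdzP[q ->]; exists q, 1; split; last by rewrite mulr1 mulrC.
by rewrite dvdzE dvdn1 gtn_eqF // prime_gt1.
Qed.

Lemma dvd_psmall e (n : int) : psmall e n%:~R -> (p%:Z ^+ e %| n)%Z.
Proof.
move=> [n' [w [pw /eqP]]]; rewrite -intrM eqr_int => /eqP E.
have : (p%:Z ^+ e %| n * w)%Z by rewrite E dvdz_mulr.
rewrite mulrC Gauss_dvdzr // /coprimez /gcdz; rewrite -/(coprimez _ _).
by rewrite /coprimez /gcdz eqz_nat -/(coprime _ _) abszX coprimeXl // prime_coprime.
Qed.

Lemma psmall_unit e (w : nat) x : ~~ (p %| w)%N -> psmall e (w%:R * x) -> psmall e x.
Proof.
move=> pw [n [w' [pw' E]]]; exists n, (w%:Z * w'); split; first exact: Euclid.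
by rewrite intrM -E -pmulrn; ring.
Qed.

End Small.

(** * Denominators and sizes of the Taylor coefficients *)

Section CoefficientRatio.
Variables (r s u v : nat).
Hypotheses (s_gt0 : (0 < s)%N) (u_gt0 : (0 < u)%N) (v_gt0 : (0 < v)%N).
Hypothesis cop_uv : coprime u v.

Definition cratio i : rat := rising (r%:R / s%:R) i / rising (u%:R / v%:R) i.

Let aprod (x y : nat) i := (\prod_(t < i) (x + t * y))%N.

Let arithprodE (x y : nat) i : arithprod x%:Z y i = (aprod x y i)%:Z.
Proof.
by rewrite -[RHS]natz natr_prod; apply: eq_bigr => t _; rewrite natz PoszD PoszM.
Qed.

Let u_prod0 i : (aprod u v i)%:R != 0 :> rat.
Proof. by rewrite pnatr_eq0 -lt0n; apply: prodn_gt0 => t; rewrite ltn_addr. Qed.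

Lemma cratioE i : s%:R ^+ i * cratio i
  = v%:R ^+ i * ((aprod r s i)%:R / (aprod u v i)%:R).
Proof.
rewrite /cratio 2!pmulrn (rising_frac r _ s_gt0) (rising_frac u _ v_gt0) !arithprodE -!pmulrn.
have s0 : s%:R ^+ i != 0 :> rat by rewrite expf_neq0 // pnatr_eq0 -lt0n.
have v0 : v%:R ^+ i != 0 :> rat by rewrite expf_neq0 // pnatr_eq0 -lt0n.
by have := u_prod0 i => u0; field; rewrite u0 v0 s0.
Qed.

(** One [d ^ i] turns the ratio into [s0 ^ i] times a quotient of integer products, the second is
    the one required by [arith_prod_dvd]. *)
Lemma cratio_int s0 d e L i : (0 < s0)%N -> (s0 * s = d * v)%N -> (d %| e)%N ->
  (forall t, (t < i)%N -> (u + t * v %| L)%N) ->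
  e%:R ^+ i.*2 * L%:R * cratio i \is a Num.int.
Proof.
move=> s00 sdv /dvdnP[q ->] dL.
have := arith_prod_dvd r cop_uv u_gt0 s_gt0 v_gt0 sdv dL => /dvdnP[z zE].
have v0 : v%:R ^+ i != 0 :> rat by rewrite expf_neq0 // pnatr_eq0 -lt0n.
have E : d%:R ^+ i * cratio i = s0%:R ^+ i * ((aprod r s i)%:R / (aprod u v i)%:R).
  have E1 : d%:R ^+ i * v%:R ^+ i = s0%:R ^+ i * s%:R ^+ i :> rat.
    by rewrite -!natrX -!natrM -!expnMn sdv.
  apply: (mulfI v0); transitivity (d%:R ^+ i * v%:R ^+ i * cratio i); first by ring.
  by rewrite E1 -mulrA cratioE; ring.
have -> : (q * d)%:R ^+ i.*2 * L%:R * cratio i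
  = q%:R ^+ i.*2 * s0%:R ^+ i * ((d ^ i * aprod r s i * L)%:R / (aprod u v i)%:R).
  transitivity (q%:R ^+ i.*2 * d%:R ^+ i * L%:R * (d%:R ^+ i * cratio i)).
    by rewrite natrM exprMn -addnn [d%:R ^+ (i + i)]exprD; ring.
  by rewrite E !natrM natrX; ring.
rewrite zE natrM -/(aprod u v i) mulfK ?u_prod0 //.
by rewrite rpredM ?natr_int // rpredM // rpredX // natr_int.
Qed.

(** This controls the ratios of large index with a fixed [Y], at the cost of [p ^ t]. The [p]-part
    of each [u + j * v] is at most [Y * p ^ t], so it divides [lcmupto Y * p ^ t]; the parts prime
    to [p] are collected in the [p]-adic unit [W], and [s] is a unit as well. *)
Lemma psmall_cratio p Y t i : prime p -> ~~ (p %| s)%N -> (0 < Y)%N ->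
  (u + i * v <= Y * p ^ t)%N ->
  psmall p 0 ((lcmupto Y)%:R * p%:R ^+ t * cratio i).
Proof.
move=> pr ps Y0 le_i; have p_gt0 := prime_gt0 pr.
pose W := (\prod_(j < i) (u + j * v)`_p^')%N.
have pW : ~~ (p %| W)%N.
  apply: (big_ind (fun n => ~~ (p %| n)%N)) => [|x y px py|j _].
  - by rewrite dvdn1 gtn_eqF // prime_gt1.
  - by rewrite Euclid_dvdM // negb_or px.
  - by rewrite -p'natE // part_pnat.
pose L := (lcmupto Y * p ^ t * W)%N.
have dL j : (j < i)%N -> (u + j * v %| L)%N.
  move=> ji; have n0 : (0 < u + j * v)%N by rewrite ltn_addr.
  rewrite -(partnC p n0) dvdn_mul //; last first.
    by rewrite /W (bigD1 (Ordinal ji)) //= dvdn_mulr.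
  rewrite p_part; set e := logn p _.
  have en : (p ^ e <= Y * p ^ t)%N.
    apply: leq_trans le_i; apply: leq_trans (dvdn_leq n0 (pfactor_dvdnn p _)) _.
    by rewrite leq_add2l leq_mul2r ltnW ?orbT.
  have [et|te] := leqP e t; first by rewrite dvdn_mull // dvdn_exp2l.
  rewrite -(subnK (ltnW te)) expnD dvdn_mul // dvdn_lcmupto // expn_gt0 p_gt0 /=.
  by move: en; rewrite -{1}(subnK (ltnW te)) expnD leq_pmul2r // expn_gt0 p_gt0.
have /dvdnP[z zE] := arith_prod_dvd_fact_lcm cop_uv u_gt0 dL.
have := fact_dvd_arith_prod r i s_gt0.
rewrite -/(arithprod r s i) arithprodE dvdzE abszM abszX /= => /dvdnP[z' zE'].
apply: (@psmall_unit p pr 0 (s ^ i.*2 * W)%N).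
  rewrite Euclid_dvdM // negb_or pW andbT; case: (i.*2) => [|n].
    by rewrite expn0 dvdn1 gtn_eqF // prime_gt1.
  by rewrite Euclid_dvdX // (negPf ps).
apply: psmall_int => //.
have -> : (s ^ i.*2 * W)%:R * ((lcmupto Y)%:R * p%:R ^+ t * cratio i)
  = v%:R ^+ i * z'%:R * z%:R.
  transitivity (s%:R ^+ i * L%:R * (s%:R ^+ i * cratio i)).
    by rewrite /L !natrM -addnn expnD !natrM !natrX; ring.
  rewrite cratioE.
  transitivity (v%:R ^+ i * ((s ^ i * aprod r s i)%:R * L%:R / (aprod u v i)%:R) : rat).
    by rewrite natrM natrX; ring.
  by rewrite zE' natrM -[_ * _ * L%:R]mulrA -natrM zE natrM -!mulrA divff ?u_prod0 ?mulr1 // mulrA.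
by rewrite rpredM ?natr_int // rpredM ?natr_int // rpredX // natr_int.
Qed.

End CoefficientRatio.

(** * Archimedean bounds for [mbinom] and for the coefficient ratios *)

Section Sizes.

Lemma mbinom_le_exp2 (x : rat) B n : `|x| <= B.+1%:R -> `|mbinom x n| <= 2 ^+ (B + n).
Proof.
move=> xB; have f0 : (0 : rat) < n`!%:R by rewrite ltr0n fact_gt0.
have C2 : 'C(B + n, n)%:R <= 2 ^+ (B + n) :> rat by rewrite -natrX ler_nat bin_le_exp2.
apply: le_trans C2; rewrite /mbinom normrM normfV (gtr0_norm f0) ler_pdivrMr //.
rewrite -natrM bin_ffact ffact_prod /rising normr_prod (reindex_inj rev_ord_inj) /= natr_prod.
apply: ler_prod => t _; rewrite normr_ge0 /=; apply: le_trans (ler_normD _ _) _.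
have -> : (B + n - t)%:R = B.+1%:R + (n - t.+1)%:R :> rat.
  by rewrite -natrD; congr (_%:R); have := ltn_ord t; lia.
by rewrite lerD // ger0_norm // ler0n.
Qed.

(** All factors are negative or zero and shrink in absolute value, so the comparison is with
    ['C(B + M, n)]; [mbinom_le_exp2] would bring [n] into the exponent. *)
Lemma mbinom_neg_le_exp2 (x : rat) B M n : 0 < x -> x <= B%:R -> (n <= M)%N ->
  `|mbinom (1 - x - M%:R) n| <= 2 ^+ (B + M).
Proof.
move=> x0 xB nM; have f0 : (0 : rat) < n`!%:R by rewrite ltr0n fact_gt0.
have C2 : 'C(B + M, n)%:R <= 2 ^+ (B + M) :> rat by rewrite -natrX ler_nat bin_le_exp2.
apply: le_trans C2; rewrite /mbinom normrM normfV (gtr0_norm f0) ler_pdivrMr //.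
rewrite -natrM bin_ffact ffact_prod /rising normr_prod natr_prod.
apply: ler_prod => t _; rewrite normr_ge0 /=; have tn := ltn_ord t.
have -> : 1 - x - M%:R + t%:R = - (x + (M - t.+1)%:R).
  by rewrite natrB -?natr1; [ring | lia].
have -> : (B + M - t)%:R = B%:R + (M - t)%:R :> rat by rewrite -natrD; congr (_%:R); lia.
by rewrite normrN ger0_norm ?addr_ge0 ?ler0n ?(ltW x0) // lerD // ler_nat; lia.
Qed.

Lemma cratio_bounds (x c : rat) i : 0 < x -> 0 <= c ->
  0 <= rising x i / rising (x + c) i <= 1.
Proof.
move=> x0 c0; have xc : 0 < x + c by rewrite ltr_wpDr.
rewrite divr_ge0 ?(ltW (rising_gt0 _ _)) //= ler_pdivrMr ?rising_gt0 // mul1r.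
apply: ler_prod => t _; have t0 : 0 <= t%:R :> rat by rewrite ler0n.
by rewrite addr_ge0 ?(ltW x0) //=; lra.
Qed.

End Sizes.

(** * The main estimate *)

Lemma leq_expl n1 n2 k : (n1 <= n2)%N -> (n1 ^ k <= n2 ^ k)%N.
Proof. by case: k => // k; rewrite leq_exp2r. Qed.

Section GlobalRelation.
Variables (m r0 s0 d V U A : nat) (r s u v : 'I_m -> nat) (dv : 'I_m -> nat).
Hypotheses (m_gt0 : (0 < m)%N) (r0_gt0 : (0 < r0)%N) (s0_gt0 : (0 < s0)%N) (d_gt0 : (0 < d)%N).
Hypotheses (r_gt0 : forall j, (0 < r j)%N) (s_gt0 : forall j, (0 < s j)%N).
Hypotheses (u_gt0 : forall j, (0 < u j)%N) (v_gt0 : forall j, (0 < v j)%N).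
Hypothesis cop_uv : forall j, coprime (u j) (v j).
Hypothesis sdv : forall j, (s0 * s j = dv j * v j)%N.
Hypothesis dv_d : forall j, (dv j %| d)%N.
Hypotheses (uU : forall j, (u j <= U)%N) (vV : forall j, (v j <= V)%N).

Let c : rat := r0%:R / s0%:R.
Let x (j : 'I_m) : rat := (r j)%:R / (s j)%:R.

Hypothesis x_c : forall j, x j + c = (u j)%:R / (v j)%:R.
Hypotheses (cA : c <= A%:R) (xA : forall j, x j <= A%:R).
Hypothesis x_sep : forall i j (b b' : nat), x i + b%:R = x j + b'%:R -> i = j.

Variables (a : int) (l0 : int) (l : 'I_m -> int).
Hypotheses (a_neq0 : a != 0) (cop_as : forall j, coprime `|a| (s j)).

Let cr (j : 'I_m) i : rat := rising (x j) i / rising (x j + c) i.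

Definition partial_rel k : rat :=
  l0%:~R + \sum_j (l j)%:~R * \sum_(i < k) cr j i * a%:~R ^+ i.

Hypothesis relation : forall p, prime p -> (p %| `|a|)%N ->
  forall e, exists K0, forall K, (K0 <= K)%N -> psmall p e (partial_rel K).

Let c_gt0 : 0 < c. Proof. by rewrite divr_gt0 ?ltr0n. Qed.
Let x_gt0 j : 0 < x j. Proof. by rewrite divr_gt0 ?ltr0n. Qed.
Let crE j i : cr j i = cratio (r j) (s j) (u j) (v j) i.
Proof. by rewrite /cr /cratio x_c. Qed.

Let Uv_le j t n i : (t <= n)%N -> (U + n * V <= i)%N -> (u j + t * v j <= i)%N.
Proof.
by move=> tn; apply: leq_trans; rewrite leq_add ?uU // leq_mul.
Qed.

Section Form.
Variables (N e : nat).
Hypothesis e_le : (e <= m)%N.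
Let M := (m * N.+1)%N.
Let G : {poly rat} := 'X^e * ptpoly x N.

(** The division turns the values of [ptpoly] into products of [mbinom], whose size and denominators
    grow only exponentially in [N]. *)
Definition qcoef k : rat := ecoef c M G k / (N`!%:R) ^+ m.
Definition numform : rat := \sum_(k < M.+1) qcoef k * (a%:~R ^+ (M - k) * partial_rel k).

Let f0 : (N`!%:R) ^+ m != 0 :> rat.
Proof. by rewrite expf_neq0 // fact_neq0. Qed.

Let qcoefE k : qcoef k = \sum_(i < k.+1) mbinom (c - 1) (k - i) *
  (mbinom (1 - c - M%:R) i * ((- i%:R) ^+ e * (-1) ^+ (m * N) *
     \prod_j mbinom (x j + i%:R) N)).
Proof.
rewrite /qcoef mulr_suml; apply: eq_bigr => i _; rewrite -!mulrA; do 2! congr (_ * _).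
rewrite /G hornerM hornerXn -mulrA; congr (_ * _).
have -> : (ptpoly x N).[- i%:R] = (-1) ^+ (m * N) * \prod_j rising (x j + i%:R) N.
  rewrite horner_prod /pts big_allpairs_dep /= big_enum /=.
  have -> : (-1) ^+ (m * N) = \prod_(j < m) \prod_(b < N) (-1) :> rat.
    by rewrite !prodr_const !card_ord mulnC exprM.
  rewrite -big_split /=; apply: eq_bigr => j _.
  rewrite -[X in iota 0 X]subn0 -/(index_iota _ _) big_mkord /rising.
  rewrite -big_split /=; apply: eq_bigr => b _.
  by rewrite hornerXsubC; ring.
by rewrite /mbinom big_split /= prodfV prodr_const card_ord -!mulrA.
Qed.

(** By [mbinom_frac_int], the two [mbinom] with denominator [s0] need the exponent
    [2 (k - i) + 2 i <= 2 M], and each [mbinom (x j + i) N] needs [2 N]. *)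
Definition qden : nat := (s0 ^ M.*2 * (\prod_j s j) ^ N.*2)%N.

Let natX_int (n k : nat) : n%:R ^+ k \is a @Num.int rat.
Proof. by rewrite rpredX // natr_int. Qed.

Let qcoef_int k : (k <= M)%N -> qden%:R * qcoef k \is a Num.int.
Proof.
move=> kM; rewrite qcoefE mulr_sumr rpred_sum // => i _.
have ik : (i <= k)%N by rewrite leq_ord.
have s0n : s0%:R != 0 :> rat by rewrite pnatr_eq0 -lt0n.
have A1 : s0%:R ^+ (k - i).*2 * mbinom (c - 1) (k - i) \is a Num.int.
  have -> : c - 1 = (r0%:Z - s0%:Z)%:~R / s0%:R.
    by rewrite intrB -!pmulrn mulrBl divff.
  exact: mbinom_frac_int.
have A2 : s0%:R ^+ i.*2 * mbinom (1 - c - M%:R) i \is a Num.int.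
  have -> : 1 - c - M%:R = (s0%:Z - r0%:Z - M%:Z * s0%:Z)%:~R / s0%:R.
    by rewrite !intrB intrM -!pmulrn /c; field.
  exact: mbinom_frac_int.
have A3 : \prod_j ((s j)%:R ^+ N.*2 * mbinom (x j + i%:R) N) \is a Num.int.
  apply: rpred_prod => j _; have sjn : (s j)%:R != 0 :> rat by rewrite pnatr_eq0 -lt0n.
  have -> : x j + i%:R = ((r j)%:Z + i%:Z * (s j)%:Z)%:~R / (s j)%:R.
    by rewrite intrD intrM -!pmulrn /x; field.
  exact: mbinom_frac_int.
have -> : qden%:R = s0%:R ^+ (M - k).*2 * (s0%:R ^+ (k - i).*2 * s0%:R ^+ i.*2)
   * \prod_j (s j)%:R ^+ N.*2 :> rat.
  rewrite /qden natrM !natrX natr_prod prodrXl; congr (_ * _).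
  by rewrite -!exprD; congr (_ ^+ _); lia.
rewrite big_split /= in A3.
set P1 := \prod_j _ in A3 *; set P2 := \prod_j _ in A3 *.
have -> : s0%:R ^+ (M - k).*2 * (s0%:R ^+ (k - i).*2 * s0%:R ^+ i.*2) * P1 *
  (mbinom (c - 1) (k - i) * (mbinom (1 - c - M%:R) i * ((- i%:R) ^+ e * (-1) ^+ (m * N) * P2)))
  = s0%:R ^+ (M - k).*2 * (s0%:R ^+ (k - i).*2 * mbinom (c - 1) (k - i)) *
    (s0%:R ^+ i.*2 * mbinom (1 - c - M%:R) i) * (P1 * P2) * ((- i%:R) ^+ e * (-1) ^+ (m * N)) by ring.
apply: rpredM; first by rewrite rpredM // rpredM // rpredM // natX_int.
by rewrite rpredM // rpredX // rpredN ?rpred1 // natr_int.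
Qed.

(** The partial sums involve indices up to [M]; the range up to [M + N] serves the first tail terms
    that survive in [numform_small]. *)
Definition lcmbound : nat := (U + (M + N) * V)%N.
Definition clearing : nat := (qden * d ^ M.*2 * lcmupto lcmbound)%N.

Let numform_int : clearing%:R * numform \is a Num.int.
Proof.
rewrite mulr_sumr rpred_sum // => k _; have kM := leq_ord k.
have -> : clearing%:R * (qcoef k * (a%:~R ^+ (M - k) * partial_rel k))
  = qden%:R * qcoef k * a%:~R ^+ (M - k) *
    ((d ^ M.*2 * lcmupto lcmbound)%:R * partial_rel k).
  by rewrite /clearing -mulnA natrM; ring.
apply: rpredM; first by rewrite rpredM ?qcoef_int // rpredX // intr_int.
rewrite mulrDr rpredD //; first by rewrite rpredM ?natr_int ?intr_int.
rewrite mulr_sumr rpred_sum // => j _; rewrite mulrCA rpredM ?intr_int //.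
rewrite mulr_sumr rpred_sum // => i _; rewrite mulrA rpredM //; last first.
  by rewrite rpredX // intr_int.
have iM : (i <= M)%N by apply: leq_trans kM; apply: ltnW.
have -> : (M.*2 = (M - i).*2 + i.*2)%N by lia.
rewrite expnD !natrM !natrX -!mulrA rpredM ?natX_int // mulrA crE.
apply: cratio_int (sdv j) (dv_d j) _ => // t ti.
rewrite dvdn_lcmupto // ltn_addr //=; apply: (@Uv_le _ _ (M + N)) => //.
by rewrite (leq_trans (ltnW ti)) // (leq_trans iM) // leq_addr.
Qed.

(* The end point [K + k] moves with [k], so that reindexing by [b = i - k] below involves
   no boundary terms. *)
Let partial_rel_shift k K : partial_rel k = partial_rel (K + k)
  - \sum_j (l j)%:~R * \sum_(b < K) cr j (k + b) * a%:~R ^+ (k + b).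
Proof.
rewrite /partial_rel -addrA -sumrB; congr (_ + _); apply: eq_bigr => j _.
by rewrite -mulrBr [(K + k)%N]addnC big_split_ord /= addrK.
Qed.

Let size_G : (size G <= M.+1)%N.
Proof.
rewrite /G size_monicM ?monicXn ?ptpoly_neq0 // size_polyXn size_prod_XsubC size_pts.
by rewrite /M mulnS /=; lia.
Qed.

(** The Pade property: [x j + b] is a root of [G]. *)
Let tail_vanish j b : (b < N)%N -> \sum_(k < M.+1) qcoef k * cr j (k + b) = 0.
Proof.
move=> bN; have := ecoef_convolution c_gt0 b (x_gt0 j) size_G.
have -> : G.[x j + b%:R] = 0.
  rewrite /G hornerM; apply/eqP; rewrite mulf_eq0; apply/orP; right.
  by rewrite -/(root _ _) root_prod_XsubC (mem_pts x_sep).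
rewrite mulr0 mul0r mulr0 => /(congr1 (fun z => z / (N`!%:R) ^+ m)).
rewrite mul0r mulr_suml => E; apply: etrans E.
by apply: eq_bigr => k _; rewrite /qcoef -/(cr _ _) mulrAC.
Qed.

Let numform_split K : numform = \sum_(k < M.+1) qcoef k * (a%:~R ^+ (M - k) * partial_rel (K + k))
  - \sum_j (l j)%:~R * \sum_(b < K) a%:~R ^+ (M + b) * \sum_(k < M.+1) qcoef k * cr j (k + b).
Proof.
transitivity (\sum_(k < M.+1) qcoef k * (a%:~R ^+ (M - k) * partial_rel (K + k))
  - \sum_(k < M.+1) qcoef k * (a%:~R ^+ (M - k) *
     \sum_j (l j)%:~R * \sum_(b < K) cr j (k + b) * a%:~R ^+ (k + b))).
  rewrite -sumrB; apply: eq_bigr => k _.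
  by rewrite -mulrBr -mulrBr -partial_rel_shift.
congr (_ - _).
transitivity (\sum_(k < M.+1) \sum_j \sum_(b < K)
   (l j)%:~R * (a%:~R ^+ (M + b) * (qcoef k * cr j (k + b)))).
  apply: eq_bigr => k _; rewrite !mulr_sumr; apply: eq_bigr => j _; rewrite !mulr_sumr.
  apply: eq_bigr => b _.
  have -> : (M + b = M - k + (k + b))%N by have := leq_ord k; lia.
  by rewrite [a%:~R ^+ (M - k + (k + b))]exprD; ring.
rewrite exchange_big; apply: eq_bigr => j _; rewrite exchange_big mulr_sumr.
by apply: eq_bigr => b _; rewrite !mulr_sumr.
Qed.

(** In [numform_split], the partial sums far out are small by [relation], the tail terms with
    [b < N] cancel, and those with [b >= N] carry [a ^ (M + N)]. *)
Let numform_small p : prime p -> (p %| `|a|)%N ->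
  psmall p (logn p `|a| * (M + N)) (clearing%:R * numform).
Proof.
move=> pr pa; set f := logn p `|a|; set T := (f * _)%N.
have f_gt0 : (0 < f)%N by rewrite logn_gt0 mem_primes pr pa absz_gt0 a_neq0.
have ps j : ~~ (p %| s j)%N.
  apply/negP => psj; have : (p %| gcdn `|a| (s j))%N by rewrite dvdn_gcd pa.
  by rewrite (eqP (cop_as j)) dvdn1 gtn_eqF ?prime_gt1.
have apf : psmall p f a%:~R.
  by apply: psmall_dvd => //; rewrite dvdzE abszX /= pfactor_dvdnn.
have [K0 relK] := relation pr pa T.
rewrite (numform_split K0) mulrBr -[_ - _]/(_ + - _) -mulrN; apply: psmallD => //.
  rewrite mulr_sumr; apply: psmall_sum => // k _.
  have -> : clearing%:R * (qcoef k * (a%:~R ^+ (M - k) * partial_rel (K0 + k)))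
   = (d ^ M.*2 * lcmupto lcmbound)%:R * (qden%:R * qcoef k) * a%:~R ^+ (M - k) * partial_rel (K0 + k).
    by rewrite /clearing -mulnA natrM; ring.
  apply: psmallMint => //; first by apply: relK; rewrite leq_addr.
  rewrite rpredM //; last by rewrite rpredX // intr_int.
  by rewrite rpredM ?natr_int // qcoef_int // leq_ord.
rewrite mulrN -mulNr mulr_sumr; apply: psmall_sum => // j _.
rewrite mulrCA; apply: psmallMint => //.
rewrite mulr_sumr; apply: psmall_sum => // b _.
have [bN|Nb] := ltnP b N; first by rewrite tail_vanish // !mulr0; apply: psmall0.
rewrite !mulr_sumr; apply: psmall_sum => // k _.
have kM := leq_ord k; have bE : (b = N + (b - N) :> nat)%N by rewrite subnKC.
move: (b - N)%N bE => t bE; rewrite bE.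
have /dvdnP[q aq] := pa.
(* Each of the [t] surplus factors [a] supplies one [p], which pays for the [p ^ t] of
   [psmall_cratio]. *)
have aE : a = sgz a * q%:Z * p%:Z by rewrite -mulrA -PoszM -aq -intEsg.
have -> : - clearing%:R * (a%:~R ^+ (M + (N + t)) * (qcoef k * cr j (k + (N + t))))
  = - (d ^ M.*2)%:R * (qden%:R * qcoef k) * (sgz a * q%:Z)%:~R ^+ t *
   (a%:~R ^+ (M + N) * ((lcmupto lcmbound)%:R * p%:R ^+ t * cr j (k + (N + t)))).
  rewrite addnA exprD {2}aE intrM exprMn /clearing !natrM -[p%:~R]pmulrn; ring.
apply: psmallMint => //.
  rewrite -[T]addn0; apply: psmallM => //; first exact: psmallX.
  rewrite crE; apply: psmall_cratio => //.
    by rewrite /lcmbound ltn_addr // (leq_trans (u_gt0 j)).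
  apply: (@Uv_le _ _ (M + N + t)); first by lia.
  have pt : (t.+1 <= p ^ t)%N by rewrite ltn_expl // prime_gt1.
  apply: leq_trans (leq_mul (leqnn _) pt); rewrite /lcmbound.
  by rewrite mulnS mulnDl addnA leq_add2l mulnC; nia.
rewrite rpredM //; last by rewrite rpredX // intr_int.
by rewrite rpredM ?rpredN ?natr_int // qcoef_int.
Qed.

Let abs_a : `|a%:~R| = (`|a|%N)%:R :> rat.
Proof. by rewrite -intr_norm -abszE. Qed.

Let absa_gt0 : (0 < `|a|)%N. Proof. by rewrite absz_gt0. Qed.

Let qcoef_size k : (k <= M)%N ->
  `|qcoef k| <= (M.+1 ^ m.+1 * 2 ^ (A.*2 + M.*2 + m * (A + M + N)))%:R.
Proof.
move=> kM; rewrite qcoefE; apply: le_trans (ler_norm_sum _ _ _) _.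
pose B := (M.+1 ^ m * 2 ^ (A.*2 + M.*2 + m * (A + M + N)))%N.
suff term (i : 'I_k.+1) : `|mbinom (c - 1) (k - i) *
    (mbinom (1 - c - M%:R) i * ((- i%:R) ^+ e * (-1) ^+ (m * N) *
     \prod_j mbinom (x j + i%:R) N))| <= B%:R.
  apply: le_trans (ler_sum _ (fun i _ => term i)) _.
  rewrite sumr_const card_ord -mulrnA mulnC ler_nat expnS -mulnA leq_mul2r.
  by rewrite ltnS kM orbT.
have ik : (i <= k)%N by rewrite leq_ord.
have b1 : `|mbinom (c - 1) (k - i)| <= 2 ^+ (A + M).
  apply: le_trans (mbinom_le_exp2 (B := A) _ _) _.
    by rewrite ler_norml -natr1; have := c_gt0; have := cA; lra.
  by rewrite ler_eXn2l ?ltr1n // leq_add2l; lia.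
have b2 : `|mbinom (1 - c - M%:R) i| <= 2 ^+ (A + M).
  by apply: mbinom_neg_le_exp2 => //; apply: leq_trans kM.
have b3 : `|(- i%:R) ^+ e * (-1) ^+ (m * N)| <= M.+1%:R ^+ m :> rat.
  rewrite normrM !normrX normrN normrN1 expr1n mulr1 ger0_norm ?ler0n //.
  rewrite -!natrX ler_nat; apply: leq_trans (leq_pexp2l _ e_le) => //.
  by rewrite leq_expl // leqW // (leq_trans ik).
have b4 : `|\prod_j mbinom (x j + i%:R) N| <= 2 ^+ (m * (A + M + N)).
  rewrite normr_prod mulnC exprM -[X in _ <= _ ^+ X]card_ord -prodr_const.
  apply: ler_prod => j _; rewrite normr_ge0 /=; apply: mbinom_le_exp2.
  rewrite ger0_norm ?addr_ge0 ?ler0n ?(ltW (x_gt0 j)) // -[(A + M).+1]addn1 !natrD.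
  have : (i%:R : rat) <= M%:R by rewrite ler_nat (leq_trans ik).
  by have := xA j; lra.
have -> : B%:R = 2 ^+ (A + M) * (2 ^+ (A + M) * (M.+1%:R ^+ m * 2 ^+ (m * (A + M + N)))) :> rat.
  have -> : B = (2 ^ (A + M) * (2 ^ (A + M) * (M.+1 ^ m * 2 ^ (m * (A + M + N)))))%N.
    by rewrite /B mulnCA [(2 ^ (A + M) * (_ ^ m * _))%N]mulnCA -!expnD; congr (_ * _ ^ _)%N; lia.
  by rewrite !natrM !natrX.
rewrite normrM ler_pM // normrM ler_pM // normrM ler_pM //.
Qed.

Let coefsum : nat := (`|l0| + \sum_j `|l j|)%N.

Let partial_rel_size k : (k <= M)%N ->
  `|a%:~R ^+ (M - k) * partial_rel k| <= (coefsum * M.+1 * `|a| ^ M)%:R.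
Proof.
move=> kM; rewrite normrM normrX abs_a.
have a1 : 1 <= (`|a|%N)%:R :> rat by rewrite ler1n.
have cr_size j : `|\sum_(i < k) cr j i * a%:~R ^+ i| <= k%:R * (`|a|%N)%:R ^+ k.
  apply: le_trans (ler_norm_sum _ _ _) _.
  have t (i : 'I_k) : `|cr j i * a%:~R ^+ i| <= (`|a|%N)%:R ^+ k.
    have /andP[cr0 cr1] := cratio_bounds i (x_gt0 j) (ltW c_gt0).
    rewrite normrM normrX abs_a (ger0_norm cr0) -[leRHS]mul1r ler_pM ?exprn_ge0 ?ler0n //.
    by rewrite ler_weXn2l // ltnW.
  apply: le_trans (ler_sum _ (fun i _ => t i)) _.
  by rewrite sumr_const card_ord mulr_natl.
have -> : (coefsum * M.+1 * `|a| ^ M)%:R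
   = (`|a|%N)%:R ^+ (M - k) * (coefsum%:R * (M.+1%:R * (`|a|%N)%:R ^+ k)) :> rat.
  have -> : (`|a| ^ M = `|a| ^ (M - k) * `|a| ^ k)%N by rewrite -expnD subnK.
  by rewrite !natrM !natrX; ring.
rewrite ler_wpM2l ?exprn_ge0 //.
apply: le_trans (ler_normD _ _) _; rewrite /coefsum natrD natr_sum mulrDl lerD //.
  rewrite -intr_norm -abszE -pmulrn -[leLHS]mulr1 ler_wpM2l //.
  by rewrite -[leLHS]mulr1 ler_pM // ?ler1n // exprn_ege1.
apply: le_trans (ler_norm_sum _ _ _) _; rewrite mulr_suml ler_sum // => j _.
rewrite normrM -intr_norm -abszE -pmulrn ler_wpM2l //.
apply: le_trans (cr_size j) _; rewrite ler_wpM2r ?exprn_ge0 // ler_nat.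
by rewrite (leq_trans kM).
Qed.

Let numform_size : `|numform| <=
  (M.+1 ^ m.+3 * 2 ^ (A.*2 + M.*2 + m * (A + M + N)) * coefsum * `|a| ^ M)%:R.
Proof.
apply: le_trans (ler_norm_sum _ _ _) _.
have t (k : 'I_M.+1) : `|qcoef k * (a%:~R ^+ (M - k) * partial_rel k)| <=
   ((M.+1 ^ m.+1 * 2 ^ (A.*2 + M.*2 + m * (A + M + N)))
    * (coefsum * M.+1 * `|a| ^ M))%:R.
  have kM := leq_ord k.
  by rewrite normrM natrM ler_pM // ?qcoef_size ?partial_rel_size.
apply: le_trans (ler_sum _ (fun i _ => t i)) _.
rewrite sumr_const card_ord -mulrnA mulnC ler_nat.
by rewrite ![in leqRHS]expnS expnS; apply: eq_leq; ring.
Qed.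

(** The cleared form is a nonzero integer divisible by [a ^ (M + N)], prime by prime, so its
    absolute value is at least that large. *)
Lemma numform_bound : numform != 0 ->
  (`|a| ^ (M + N) <= clearing * (M.+1 ^ m.+3 *
     2 ^ (A.*2 + M.*2 + m * (A + M + N)) * coefsum * `|a| ^ M))%N.
Proof.
move=> nz; have /intrP[I IE] := numform_int.
have clear_gt0 : (0 < clearing)%N.
  by rewrite /clearing /qden !muln_gt0 !expn_gt0 s0_gt0 d_gt0 lcmupto_gt0 prodn_gt0.
have I0 : I != 0.
  rewrite -(intr_eq0 rat) -IE mulf_neq0 // pnatr_eq0 -lt0n //.
have divI : (`|a| ^ (M + N) %| `|I|)%N.
  apply/dvdn_partP => [|p]; first by rewrite expn_gt0 absa_gt0.
  move=> pp; have pr : prime p by move: pp; rewrite mem_primes => /andP[].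
  have pa : (p %| `|a|)%N.
    by move: pp; rewrite mem_primes => /and3P[_ _]; rewrite Euclid_dvdX // => /andP[].
  rewrite p_part lognX mulnC; have := numform_small pr pa.
  by rewrite IE => /(dvd_psmall pr); rewrite dvdzE abszX.
apply: leq_trans (dvdn_leq _ divI) _; first by rewrite absz_gt0.
rewrite -(ler_nat rat) pmulrn abszE intr_norm -IE normrM natrM.
by rewrite ger0_norm ?ler0n // ler_wpM2l ?ler0n.
Qed.

End Form.

Lemma no_global_relation :
  (2 ^ (m ^ 2 + 4 * m + 4) * s0 ^ m.*2 * (\prod_j s j) ^ 2 * d ^ m.*2 * 4 ^ (m.+1 * V) <= `|a|)%N ->
  forall j, l j = 0.
Proof.
set X2 := (_ * _ * _ * _ * _)%N => aX.
pose L := (`|l0| + \sum_j `|l j|)%N.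
(* [N] is the product of all factors of the upper bound that do not depend on [N]. The bound then
   reads [|a| ^ N <= N * X1 ^ N], against [|a| >= 2 * X1] and [N < 2 ^ N]. *)
pose N := (s0 ^ m.*2 * d ^ m.*2 * 4 ^ (U + m * V) * m.+1 ^ m.+3
   * 2 ^ (A.*2 + m.*2 + m * (A + m)) * L)%N.
have [[e e_le nz]|allz] : (exists2 e, (e <= m)%N & numform N e != 0) \/
    (forall e, (e <= m)%N -> numform N e = 0).
- have [/existsP[e nz]|/existsPn H] := boolP [exists e : 'I_m.+1, numform N e != 0].
    by left; exists e => //; rewrite leq_ord.
  right => e; rewrite -ltnS => em; apply/eqP/negPn; exact: H (Ordinal em).
- exfalso; have := numform_bound e_le nz; rewrite -/L.
  rewrite expnD mulnA [X in (_ <= X)%N -> _]mulnC leq_pmul2l ?expn_gt0 ?absz_gt0 ?a_neq0 //.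
  rewrite leqNgt => /negP; apply.
  pose X1 := (2 ^ (m ^ 2 + 4 * m + 3) * s0 ^ m.*2 * (\prod_j s j) ^ 2 * d ^ m.*2 * 4 ^ (m.+1 * V))%N.
  have X1_gt0 : (0 < X1)%N by rewrite /X1 !muln_gt0 !expn_gt0 s0_gt0 d_gt0 prodn_gt0.
  have X2E : X2 = (2 * X1)%N by rewrite /X2 /X1 addnS expnS !mulnA.
  have step1 : (2 ^ N * X1 ^ N <= `|a| ^ N)%N by rewrite -expnMn -X2E leq_expl.
  apply: leq_trans step1; apply: (@leq_ltn_trans (N * X1 ^ N)); last first.
    by rewrite ltn_pmul2r ?expn_gt0 ?X1_gt0 // ltn_expl.
  set M := (m * N.+1)%N.
  have E1 q : (q ^ M.*2 = q ^ m.*2 * (q ^ m.*2) ^ N)%N.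
    by rewrite -expnM -expnD /M; congr (_ ^ _)%N; rewrite -!mul2n; ring.
  have E2 : (lcmupto (lcmbound N) <= 4 ^ (U + m * V) * (4 ^ (m.+1 * V)) ^ N)%N.
    apply: leq_trans (lcmupto_le _) _; rewrite -expnM -expnD; apply: eq_leq.
    by congr (_ ^ _)%N; rewrite /lcmbound -[m.+1]addn1 mulnS; ring.
  have E3 : (M.+1 ^ m.+3 <= m.+1 ^ m.+3 * (2 ^ m.+3) ^ N)%N.
    rewrite -expnM mulnC [X in (2 ^ X)%N]mulnC expnM [(_ ^ m.+3 * _)%N]mulnC -expnMn leq_expl //.
    have : (N.+1 <= 2 ^ N)%N by rewrite ltn_expl.
    by move=> h; apply: leq_trans (leq_mul (leqnn m.+1) h); rewrite /M; lia.
  have E4 : (2 ^ (A.*2 + M.*2 + m * (A + M + N)) =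
      2 ^ (A.*2 + m.*2 + m * (A + m)) * (2 ^ (m.*2 + m * m + m)) ^ N)%N.
    by rewrite -expnM -expnD /M; congr (_ ^ _)%N; rewrite -!mul2n mulnS; ring.
  have E5 : (2 ^ (m ^ 2 + 4 * m + 3) = 2 ^ m.+3 * 2 ^ (m.*2 + m * m + m))%N.
    by rewrite -expnD; congr (_ ^ _)%N; rewrite -mul2n; lia.
  have E6 q : (q ^ N.*2 = (q ^ 2) ^ N)%N by rewrite -expnM mul2n.
  rewrite /clearing /qden -/M !E1 E4 E6.
  set S := (\prod_j s j)%N.
  apply: leq_trans (leq_mul (leq_mul (leqnn _) E2)
    (leq_mul (leq_mul E3 (leqnn _)) (leqnn _))) _.
  rewrite /X1 E5 !expnMn /N; apply: eq_leq; ring.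
- move=> j; apply: (intr_inj (R := rat)).
  apply: (@relform_vanish rat c a%:~R m x (fun j => (l j)%:~R) partial_rel _ _ _ _ _ N) => //.
  + by rewrite intr_eq0.
  + move=> k; rewrite /partial_rel mulr_sumr -addrA -big_split /=; congr (_ + _).
    by apply: eq_bigr => i _; rewrite big_ord_recr /= mulrDr /cr; ring.
  + move=> e e_le; have := allz e e_le; rewrite /numform /relform => E.
    apply: (mulIf (x := ((N`!%:R) ^+ m)^-1)); first by rewrite invr_eq0 expf_neq0 // fact_neq0.
    rewrite mul0r mulr_suml; apply: etrans E.
    by apply: eq_bigr => k _; rewrite /qcoef mulrAC.
Qed.

End GlobalRelation.

(** * Transfer from the standard library *)

Section Transfer.

Definition rat_of_Q (q : Q) : rat := (int_of_Z (Qnum q))%:~R / (Pos.to_nat (Qden q))%:R.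

Let den_neq0 (p : positive) : (Pos.to_nat p)%:R != 0 :> rat.
Proof. by rewrite pnatr_eq0; lia. Qed.

Lemma int_of_ZD (x y : Z) : int_of_Z (Z.add x y) = int_of_Z x + int_of_Z y.
Proof. lia. Qed.

Lemma int_of_ZM (x y : Z) : int_of_Z (Z.mul x y) = int_of_Z x * int_of_Z y.
Proof. lia. Qed.

Lemma int_of_ZX (x : Z) n : int_of_Z (Z.pow x (Z.of_nat n)) = int_of_Z x ^+ n.
Proof.
elim: n => [|n IH]; first by rewrite expr0.
by rewrite Nat2Z.inj_succ Z.pow_succ_r ?int_of_ZM ?IH ?exprS; lia.
Qed.

Lemma rat_of_Q_eq (p q : Q) : Qeq p q -> rat_of_Q p = rat_of_Q q.
Proof.
rewrite /Qeq /rat_of_Q => /(congr1 int_of_Z); rewrite !int_of_ZM => /(congr1 (fun z => z%:~R : rat)).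
rewrite !intrM /= -!pmulrn => E; apply/eqP.
by rewrite eqr_div // E.
Qed.

Lemma Qeq_of_rat (p q : Q) : rat_of_Q p = rat_of_Q q -> Qeq p q.
Proof.
rewrite /rat_of_Q => /eqP; rewrite eqr_div // !pmulrn -!intrM eqr_int => /eqP E.
apply: (can_inj int_of_ZK); rewrite !int_of_ZM; exact: E.
Qed.

Lemma rat_of_QD (p q : Q) : rat_of_Q (Qplus p q) = rat_of_Q p + rat_of_Q q.
Proof.
rewrite /rat_of_Q /Qplus /= int_of_ZD !int_of_ZM intrD !intrM -!pmulrn Pos2Nat.inj_mul natrM.
have := den_neq0 (Qden p); have := den_neq0 (Qden q); rewrite /= => h1 h2.
by field; rewrite h1 h2.
Qed.

Lemma rat_of_QM (p q : Q) : rat_of_Q (Qmult p q) = rat_of_Q p * rat_of_Q q.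
Proof.
rewrite /rat_of_Q /Qmult /= int_of_ZM intrM Pos2Nat.inj_mul natrM.
have := den_neq0 (Qden p); have := den_neq0 (Qden q); rewrite /= => h1 h2.
by field; rewrite h1 h2.
Qed.

Lemma rat_of_Q_inject (z : Z) : rat_of_Q (inject_Z z) = (int_of_Z z)%:~R.
Proof. by rewrite /rat_of_Q /= Pos2Nat.inj_1 divr1. Qed.

(** Holds for [q = 0] too, since both inverses send 0 to 0. *)
Lemma rat_of_QV (q : Q) : rat_of_Q (Qinv q) = (rat_of_Q q)^-1.
Proof.
have [q0|q0] := eqVneq (rat_of_Q q) 0.
  rewrite q0 invr0; have : Qeq q (inject_Z Z0).
    by apply: Qeq_of_rat; rewrite q0 rat_of_Q_inject.
  by move=> /Qinv_comp /rat_of_Q_eq ->; rewrite /rat_of_Q /= mul0r.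
apply: (mulIf q0); rewrite mulVf // -rat_of_QM.
have q1 : ~ Qeq q (inject_Z Z0).
  by move=> /rat_of_Q_eq E; move: q0; rewrite E rat_of_Q_inject eqxx.
rewrite (rat_of_Q_eq (Qeq_trans _ _ _ (Qmult_comm _ _) (Qmult_inv_r _ q1))).
exact: (rat_of_Q_inject (Zpos xH)).
Qed.

Lemma rat_of_Q_poch (q : Q) n : rat_of_Q (poch q n) = rising (rat_of_Q q) n.
Proof.
elim: n => [|n IH]; first by rewrite rising0; exact: (rat_of_Q_inject (Zpos xH)).
rewrite risingSr /= rat_of_QM IH rat_of_QD rat_of_Q_inject; congr (_ * (_ + _)).
by rewrite pmulrn; congr (_%:~R); lia.
Qed.

Lemma rat_of_Q_sum (f : nat -> Q) n : rat_of_Q (sumQ f n) = \sum_(i < n) rat_of_Q (f i).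
Proof.
elim: n => [|n IH]; first by rewrite big_ord0; exact: (rat_of_Q_inject Z0).
by rewrite big_ord_recr /= rat_of_QD IH.
Qed.

Lemma dvd_int_of_Z (x y : Z) : (int_of_Z x %| int_of_Z y)%Z <-> Z.divide x y.
Proof.
split=> [/dvdzP[q E]|[q ->]]; last by rewrite int_of_ZM dvdz_mull.
exists (Z_of_int q); apply: (can_inj int_of_ZK); rewrite int_of_ZM Z_of_intK; exact: E.
Qed.

Lemma psmall_of_padic (p : nat) k (q : Q) :
  padic_small (Z.of_nat p) k q -> psmall p k (rat_of_Q q).
Proof.
move=> [u [w [pw E]]]; exists (int_of_Z u), (int_of_Z w).
have pE : int_of_Z (Z.of_nat p) = p%:Z by lia.
split; first by apply/negP => dvd; apply: pw; apply/dvd_int_of_Z; rewrite pE.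
move/rat_of_Q_eq: E; rewrite rat_of_QM !rat_of_Q_inject => ->.
by rewrite int_of_ZM int_of_ZX pE.
Qed.

Lemma prime_of_nat (p : nat) : prime p -> Znumtheory.prime (Z.of_nat p).
Proof.
move=> pr; have p1 := prime_gt1 pr; apply: prime_intro; first by lia.
move=> n n_bd; apply/Zgcd_1_rel_prime.
have : coprime (Z.to_nat n) p.
  rewrite coprime_sym prime_coprime //; apply/negP => /dvdn_leq; lia.
rewrite /coprime => /eqP E.
have [g1 g2 _] := Zgcd_is_gcd n (Z.of_nat p).
have : (Z.to_nat (Z.gcd n (Z.of_nat p)) %| gcdn (Z.to_nat n) p)%N.
  have g0 := Z.gcd_nonneg n (Z.of_nat p).
  rewrite dvdn_gcd; apply/andP; split; apply/dvdnP.
    by case: g1 => q qE; exists (Z.to_nat q); nia.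
  by case: g2 => q qE; exists (Z.to_nat q); nia.
rewrite E dvdn1 => /eqP; have := Z.gcd_nonneg n (Z.of_nat p); lia.
Qed.

End Transfer.

(** * Application to the given [alpha], [a] and relation *)

Section Main.
Variables (m : nat) (alpha : nat -> Q) (a : Z) (l : nat -> Z).
Hypothesis hm : le 1 m.
Hypothesis hpos : forall j : nat, le j m -> Qlt (inject_Z Z0) (alpha j).
Hypothesis hnonint : forall i j : nat, le 1 i -> lt i j -> le j m ->
  forall z : Z, ~ Qeq (Qminus (alpha i) (alpha j)) (inject_Z z).
Hypothesis ha : Z.lt 1 (Z.abs a).
Hypothesis hcop : Z.gcd a (s_l m alpha) = Zpos xH.
Hypothesis hC : Rgt (ln (IZR (Z.abs a))) (logC m alpha).
Hypothesis hrel : forall p : Z, Znumtheory.prime p -> Z.divide p a ->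
  padic_tends_to_0 p (rel_partial m alpha l a).

Let num (q : Q) : nat := Z.to_nat (Qnum (Qred q)).
Let den (q : Q) : nat := Pos.to_nat (Qden (Qred q)).

Let den_gt0 q : (0 < den q)%N. Proof. by rewrite /den; lia. Qed.

Let num_gt0 q : Qlt (inject_Z Z0) q -> (0 < num q)%N.
Proof.
move=> q0; have : Qlt (inject_Z Z0) (Qred q) by rewrite Qred_correct.
by rewrite /Qlt /num /=; lia.
Qed.

Let rat_of_QE q : Qlt (inject_Z Z0) q -> rat_of_Q q = (num q)%:R / (den q)%:R.
Proof.
move=> q0; rewrite -(rat_of_Q_eq (Qred_correct q)) /rat_of_Q /den; congr (_ / _).
by have := num_gt0 q0; rewrite /num pmulrn => n0; congr (_%:~R); lia.
Qed.

Let cop_num_den q : Qlt (inject_Z Z0) q -> coprime (num q) (den q).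
Proof.
move=> q0; have := num_gt0 q0; have := den_gt0 q; have := Qred_coprime q; rewrite /num /den.
move: (Qred q) => [n d] /= g1 d0 n0.
rewrite /coprime; set g := gcdn _ _; have [gn gd] : (g %| Z.to_nat n)%N /\ (g %| Pos.to_nat d)%N.
  by rewrite dvdn_gcdl dvdn_gcdr.
have : Z.divide (Z.of_nat g) (Z.gcd n (Zpos d)).
  apply: Z.gcd_greatest.
    by move/dvdnP: gn => [k kE]; exists (Z.of_nat k); nia.
  by move/dvdnP: gd => [k kE]; exists (Z.of_nat k); nia.
by rewrite g1 => /Z.divide_1_r; lia.
Qed.

Let index_le (j : 'I_m) : le j.+1 m. Proof. by have := ltn_ord j; lia. Qed.

Let rat_of_QN q : rat_of_Q (Qopp q) = - rat_of_Q q.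
Proof.
apply/eqP; rewrite -addr_eq0 -rat_of_QD.
rewrite (rat_of_Q_eq (Qeq_trans _ _ _ (Qplus_comm _ _) (Qplus_opp_r q))).
by rewrite (rat_of_Q_inject Z0).
Qed.

Let x (j : 'I_m) : rat := (num (alpha j.+1))%:R / (den (alpha j.+1))%:R.

Let x_sep i j (b b' : nat) : x i + b%:R = x j + b'%:R -> i = j.
Proof.
have sep (i1 j1 : 'I_m) (b1 b2 : nat) : (i1 < j1)%N -> x i1 + b1%:R != x j1 + b2%:R.
  move=> ij; apply/eqP; rewrite /x -!rat_of_QE; try by apply: hpos; apply: index_le.
  have h1 : le 1 i1.+1 by lia.
  have h2 : lt i1.+1 j1.+1 by lia.
  move=> E; apply: (@hnonint _ _ h1 h2 (index_le j1) (Z_of_int (b2%:Z - b1%:Z))).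
  apply: Qeq_of_rat.
  rewrite rat_of_QD rat_of_QN rat_of_Q_inject Z_of_intK intrB -!pmulrn.
  by apply/eqP; rewrite subr_eq addrAC -subr_eq opprK E addrC.
move=> E; apply: val_inj; case: (ltngtP i j) => // [ij|ji].
  by have := sep _ _ b b' ij; rewrite E eqxx.
by have := sep _ _ b' b ji; rewrite E eqxx.
Qed.

Let cratio_of_Q j i : le j m ->
  rat_of_Q (Qdiv (poch (alpha j) i) (poch (Qplus (alpha j) (alpha O)) i))
  = rising (rat_of_Q (alpha j)) i / rising (rat_of_Q (alpha j) + rat_of_Q (alpha O)) i.
Proof. by move=> jm; rewrite rat_of_QM rat_of_QV !rat_of_Q_poch rat_of_QD. Qed.

Let r0 := num (alpha O).
Let s0 := den (alpha O).
Let aI := int_of_Z a.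

Let rel_partialE k : rat_of_Q (rel_partial m alpha l a k)
  = partial_rel r0 s0 (fun j : 'I_m => num (alpha j.+1)) (fun j => den (alpha j.+1))
      aI (int_of_Z (l O)) (fun j => int_of_Z (l j.+1)) k.
Proof.
rewrite /rel_partial /partial_rel rat_of_QD rat_of_Q_inject rat_of_Q_sum; congr (_ + _).
apply: eq_bigr => j _; rewrite rat_of_QM rat_of_Q_inject; congr (_ * _).
rewrite rat_of_Q_sum; apply: eq_bigr => i _; rewrite rat_of_QM cratio_of_Q ?index_le //.
rewrite rat_of_Q_inject int_of_ZX rmorphXn /= -/aI; congr (_ * _).
by rewrite (rat_of_QE (hpos (index_le j))) (rat_of_QE (hpos (Nat.le_0_l m))).
Qed.

Let relation p : prime p -> (p %| `|aI|)%N -> forall e, exists K0, forall K, (K0 <= K)%N ->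
  psmall p e (rat_of_Q (rel_partial m alpha l a K)).
Proof.
move=> pr pa e; have pda : Z.divide (Z.of_nat p) a.
  by apply/dvd_int_of_Z; rewrite dvdzE; have -> : `|int_of_Z (Z.of_nat p)|%N = p by lia.
have [K0 HK] := hrel (prime_of_nat pr) pda e.
by exists K0 => K /ssrnat.leP KK; apply/psmall_of_padic/HK.
Qed.

Let d := Z.to_nat (d_l m alpha).
Let V := Z.to_nat (Vmax m alpha).

Let bound : (2 ^ (m ^ 2 + 4 * m + 4) * s0 ^ m.*2 * (\prod_(j < m) den (alpha j.+1)) ^ 2
   * d ^ m.*2 * 4 ^ (m.+1 * V) <= `|aI|)%N.
Proof.
pose S := Z.to_nat (Smax m alpha).
have prod_le : (\prod_(j < m) den (alpha j.+1) <= S ^ m)%N.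
  rewrite -[m in leqRHS]card_ord -prod_nat_const leq_prod // => j _.
  have := @max_1_ge (sden alpha) m j.+1; rewrite -/(Smax m alpha) /S /sden /den.
  by have := index_le j; lia.
have /(_ hm ha hC) B := @abs_lower_bound m alpha a.
have d0 := d_l_pos m alpha.
have S0 : Z.le 0 (Smax m alpha).
  by have := @max_1_ge (sden alpha) m 1; have := sden_pos alpha 1; rewrite -/(Smax m alpha); lia.
have int_le z : Z.le z (Z.abs a) -> int_of_Z z <= `|aI|%N%:Z by rewrite /aI; lia.
have := int_le _ B; rewrite !int_of_ZM !int_of_ZX.
have -> : int_of_Z (Zpos 2) = 2%N by lia.
have -> : int_of_Z (Zpos 4) = 4%N by lia.
have -> : int_of_Z (sden alpha O) = s0 by rewrite /s0 /den /sden; lia.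
have -> : int_of_Z (Smax m alpha) = S by rewrite /S; lia.
have -> : int_of_Z (d_l m alpha) = d by rewrite /d; lia.
have natX (b n : nat) : b%:Z ^+ n = (b ^ n)%N%:Z by rewrite -[RHS]natz natrX natz.
rewrite !natX -!PoszM lez_nat !plusE !multE; apply: leq_trans.
have -> : (m ^ 2 + 4 * m + 4 = m * m + 4 * m + 4)%N by rewrite -mulnn.
rewrite mul2n -/V leq_mul2r; apply/orP; right; rewrite leq_mul2r; apply/orP; right.
by rewrite leq_mul2l; apply/orP; right; rewrite -muln2 expnM leq_expl.
Qed.

Lemma relation_coefficients_vanish (j : 'I_m) : l j.+1 = Z0.
Proof.
have lt0Z q : Qlt (inject_Z Z0) q -> 0 < rat_of_Q q.
  by move=> q0; rewrite rat_of_QE // divr_gt0 // ltr0n ?num_gt0.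
have aP (i : 'I_m) : Qlt (inject_Z Z0) (Qplus (alpha i.+1) (alpha O)).
  exact: Qplus_pos (hpos (index_le i)) (hpos (Nat.le_0_l m)).
have Z0E : int_of_Z (l j.+1) = 0; last by lia.
pose u (i : 'I_m) := num (Qplus (alpha i.+1) (alpha O)).
pose v (i : 'I_m) := den (Qplus (alpha i.+1) (alpha O)).
have frac_le (n k D : nat) : (n <= D)%N -> (0 < k)%N -> n%:R / k%:R <= D%:R :> rat.
  move=> nD k0; rewrite ler_pdivrMr ?ltr0n // -natrM ler_nat.
  by apply: leq_trans nD _; rewrite leq_pmulr.
(* Sums serve as crude upper bounds [U] and [A]: these only influence the choice of [N], not the
   size required of [a]. *)
apply: (@no_global_relation m r0 s0 d V (\sum_(i < m) u i) (r0 + \sum_(i < m) num (alpha i.+1))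
  (fun i => num (alpha i.+1)) (fun i => den (alpha i.+1)) u v
  (fun i => Z.to_nat (dj alpha i.+1)) _ _ _ _ _ _ _ _ _ _ _ _ _ _ _ _ _
  aI (int_of_Z (l O)) (fun i => int_of_Z (l i.+1))) => //.
- by lia.
- by apply: num_gt0; exact: hpos (Nat.le_0_l m).
- exact: den_gt0.
- by have := d_l_pos m alpha; rewrite /d; lia.
- by move=> i; apply: num_gt0; exact: hpos (index_le i).
- by move=> i; apply: num_gt0; exact: aP.
- by move=> i; exact: den_gt0.
- by move=> i; apply: cop_num_den; exact: aP.
- move=> i; have := dj_vden alpha i.+1; have := dj_pos alpha i.+1.
  by rewrite /sden /vden /s0 /v /den; nia.
- move=> i; have [q qE] := @lcm_1_dvd (dj alpha) m i.+1 (conj (le_n_S _ _ (Nat.le_0_l i)) (index_le i)).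
  have := dj_pos alpha i.+1; have := d_l_pos m alpha; rewrite /d /d_l qE => q1 q2.
  by apply/dvdnP; exists (Z.to_nat q); nia.
- by move=> i; rewrite (bigD1 i) //= leq_addr.
- move=> i; have := @max_1_ge (vden alpha) m i.+1 (conj (le_n_S _ _ (Nat.le_0_l i)) (index_le i)).
  by rewrite -/(Vmax m alpha) /V /v /den /vden; lia.
- move=> i; rewrite /u /v -(rat_of_QE (hpos (index_le i))) -(rat_of_QE (hpos (Nat.le_0_l m))).
  by rewrite -rat_of_QE ?rat_of_QD //; exact: aP.
- by apply: frac_le; rewrite ?leq_addr ?den_gt0.
- by move=> i; apply: frac_le; rewrite ?den_gt0 // (bigD1 i) //= addnCA leq_addr.
- by rewrite /aI; lia.
- move=> i; rewrite /coprime -dvdn1; have : Z.divide (Z.of_nat (gcdn `|aI| (den (alpha i.+1)))) (Zpos xH).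
    rewrite -hcop; apply: Z.gcd_greatest.
      have /dvdnP[q qE] := dvdn_gcdl `|aI| (den (alpha i.+1)).
      exists (Z.mul (Z.sgn a) (Z.of_nat q)); move: qE; rewrite /aI; nia.
    have sd := @lcm_1_dvd (sden alpha) m i.+1 (conj (le_n_S _ _ (Nat.le_0_l i)) (index_le i)).
    apply: (Z.divide_trans _ _ _ _ sd).
    have /dvdnP[q qE] := dvdn_gcdr `|aI| (den (alpha i.+1)).
    by exists (Z.of_nat q); move: qE; rewrite /sden {1}/den; nia.
  by move=> /Z.divide_1_r; lia.
- move=> p pr pa e; have [K0 HK] := relation pr pa e.
  by exists K0 => K KK; rewrite -rel_partialE; apply: HK.
Qed.

(** Once the other coefficients vanish, every partial sum equals [l 0]. Divisibility by [p ^ e] with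
    [e = |l 0|] forces it to be zero, as [p ^ e > e]. *)
Lemma relation_trivial j : le j m -> l j = Z0.
Proof.
case: j => [_|j jm]; last first.
  have jm' : (j < m)%N by lia.
  exact: (relation_coefficients_vanish (Ordinal jm')).
have a1 : (1 < `|aI|)%N by rewrite /aI; lia.
pose p := pdiv `|aI|; have pr : prime p by apply: pdiv_prime.
pose e := `|int_of_Z (l O)|%N.
have [K0 HK] := relation pr (pdiv_dvd _) e.
have := HK K0 (leqnn _); rewrite rel_partialE /partial_rel big1 => [|j _]; last first.
  by rewrite relation_coefficients_vanish mul0r.
rewrite addr0 => /(dvd_psmall pr); rewrite dvdzE abszX -/e /= => dvd.
have [e0|e0] := posnP e; first by move: e0; rewrite /e; lia.
by have := dvdn_leq e0 dvd; rewrite leqNgt ltn_expl // prime_gt1.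
Qed.

End Main.

End Core.

Theorem theorem3 (m : nat) (alpha : nat -> Q)
  (hm : (1 <= m)%nat)
  (hpos : forall j : nat, (j <= m)%nat -> (0 < alpha j)%Q)
  (hnonint : forall i j : nat, (1 <= i)%nat -> (i < j)%nat -> (j <= m)%nat ->
     forall z : Z, ~ (alpha i - alpha j == inject_Z z)%Q)
  (a : Z) (ha : 1 < Z.abs a) (hcop : Z.gcd a (s_l m alpha) = 1)
  (hC : (ln (IZR (Z.abs a)) > logC m alpha)%R) :
  ~ a_global_relation m alpha a.
Proof.
intros [l [[j [hj hlj]] hrel]]; apply hlj.
exact (@Core.relation_trivial m alpha a l hm hpos hnonint ha hcop hC hrel j hj).
Qed.
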